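(* The Reedy category $\Delta\circlearrowright\Omega_p$, with direct and inverse wide subcategories $(\Delta\circlearrowright\Omega_p)^+$ and $(\Delta\circlearrowright\Omega_p)^-$ and degree function $d[n\circlearrowright S]=n+|gen(n,S)|$, is elegant.
   Context: **Trees.** A planar rooted tree $S$ is a finite rooted tree with edge set $E(S)$, vertex set $V(S)$, root edge $\mathbf r=\mathbf r_S$, and a linear order on the inputs of each vertex; vertices may have no inputs; a leaf is an edge which is not the output of any vertex; the tree with one edge and no vertices is allowed. Planar trees are taken up to planar isomorphism (one representative per class). $\Omega_p(S)$ is the free nonsymmetric colored operad on $S$: its colors are the edges of $S$, and it is freely generated by one operation for each vertex, from the ordered list of inputs to the output. $\varnothing$ denotes the empty tree, with $\Omega_p(\varnothing)$ the operad with no colors. **Actions.** An action of a small category $\mathcal C$ (objects $C_0$, morphisms $C_1$, source $s$, target $t$) on a set $A$ consists of $\mu:A\to C_0$ (moment) and $\bullet:\{(f,a)\in C_1\times A:s(f)=\mu(a)\}\to A$ with $\mu(f\bullet a)=t(f)$, $(f\circ f')\bullet a=f\bullet(f'\bullet a)$, $\mathrm{id}_{\mu(a)}\bullet a=a$. For a nonsymmetric colored operad $\mathcal O$ let $\mathrm{Mor}(\mathcal O)$ be its set of operations; each operation $g$ has a source $s(g)$ (ordered list of colors) and target $t(g)$ (a color). A *rooted action* of $\mathcal C$ on $\mathcal O$ is an action of $\mathcal C$ on $\mathrm{Mor}(\mathcal O)$ with $\mu(\gamma(g;g_1,\dots,g_k))=\mu(g)$ for operadic compositions $\gamma$, and $s(f\bullet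 g)=s(g)$ as ordered lists. For a color $c$ put $\mu(c):=\mu(\mathrm{id}_c)$; then $\mu(g)=\mu(t(g))$. $\mathcal{RA}^{\mathcal Op}_{ns}$ is the category of rooted actions on nonsymmetric operads; a morphism $X$ is a functor $X^c$ between acting categories and an operad map $X^d$ with $X^c\mu=\mu X^d$ and $X^d(a\bullet f)=X^c(a)\bullet X^d(f)$. **Objects $[n\circlearrowright S]$** ($n\ge0$, $S$ a planar rooted tree). $[n]$ is the poset $0\le\dots\le n$ as a category. $\mathcal C_{n,S}$ is the disjoint union of $[n]$ and the discrete category on objects $*_e$, $e\in E(S)\setminus\{\mathbf r\}$; $p_{i,j}:i\to j$ is the unique map in $[n]$. $\mathcal O_{0,S}=\Omega_p(S)$ with $\mu(e)=*_e$ for $e\ne\mathbf r$, $\mu(\mathbf r)=0$. $\mathcal O_{n,S}$ is obtained from $\mathcal O_{n-1,S}$ by freely adjoining, for each operation $h$ of $\mathcal O_{n-1,S}$ (identities and composites included) with $\mu(h)=n-1$, a new color $(n,h)$ (distinct for distinct $h$) and a new generating operation $p_{n-1,n}\bullet h$ with source $s(h)$, target $(n,h)$ and moment $n$. The action is $p_{\ell,\ell'}\bullet h=p_{\ell'-1,\ell'}\bullet(\cdots\bullet(p_{\ell,\ell+1}\bullet h))$, identities acting trivially. This rooted action of $\mathcal C_{n,S}$ on $\mathcal O_{n,S}$ is $[n\circlearrowright S]$; $[n\circlearrowright\varnothing]$ is $[n]$ acting on the empty operad ($\mathcal C_{n,\varnothing}=[n]$, $\mathcal O_{n,\varnothing}$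 has no colors). $\Delta\circlearrowright\Omega_p$ is the full subcategory of $\mathcal{RA}^{\mathcal Op}_{ns}$ on all $[n\circlearrowright S]$ and $[n\circlearrowright\varnothing]$, $n\ge0$. **Degree.** $gen(n,S)$ is the set of generating operations of $\mathcal O_{n,S}$: the vertices of $S$ together with the adjoined operations $p_{i-1,i}\bullet h$ with $\mu(h)=i-1$, $1\le i\le n$. The degree is $d[n\circlearrowright S]=n+|gen(n,S)|=n+|\mathrm{Col}(\mathcal O_{n,S})|+|V(S)|-|E(S)|$, where $\mathrm{Col}$ denotes the set of colors. **Maps.** A map $X:[n\circlearrowright S]\to[m\circlearrowright R]$ is determined by $\alpha=X^c|_{[n]}:[n]\to\mathcal C_{m,R}$ and $\beta=X^d|_{\mathcal O_{0,S}}:\Omega_p(S)\to\mathcal O_{m,R}$; write $X=(\alpha,\beta)$, $\hat\alpha=X^c$, $\hat\beta=X^d$. **Subcategories.** $(\Delta\circlearrowright\Omega_p)^+$: maps with $\alpha:[n]\to\mathcal C_{m,R}$ injective on objects and $\beta:\Omega_p(S)\to\mathcal O_{m,R}$ injective on colors. $(\Delta\circlearrowright\Omega_p)^-$: maps such that every object of $[m]\subseteq\mathcal C_{m,R}$ is in the image of $\alpha$, $\hat\beta:\mathcal O_{n,S}\to\mathcal O_{m,R}$ is surjective on colors, and $\beta$ takes leaves of $S$ to leaves of $R$. **Reedy category.** A small category $\mathcal R$ with wide subcategories (containing all objects) $\mathcal R^+,\mathcal R^-$ and a function $d:\mathrm{Ob}\,\mathcal R\to\mathbb N$ such that every non-identity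 morphism of $\mathcal R^+$ raises degree, every non-identity morphism of $\mathcal R^-$ lowers degree, and every morphism of $\mathcal R$ factors uniquely as a morphism of $\mathcal R^-$ followed by a morphism of $\mathcal R^+$. **Elegance.** Let $F:\mathcal R\to\mathrm{Set}^{\mathcal R^{op}}$, $F(r)=\mathrm{Hom}(-,r)$, be the Yoneda functor. A Reedy category $\mathcal R$ is *elegant* if for every pair of maps $\sigma_i:r\to a_i$ ($i=1,2$) in $\mathcal R^-$ there exist $\tau_i:a_i\to b$ in $\mathcal R^-$ with $\tau_1\sigma_1=\tau_2\sigma_2$ such that the square formed by $F\sigma_1,F\sigma_2,F\tau_1,F\tau_2$ is a pushout in $\mathrm{Set}^{\mathcal R^{op}}$.
   Formalization: With the stated degree, the direct non-identity map from [0↻∅] to [0↻η] (η the one-edge tree without vertices) does not raise degree, as both degrees are 0; the formal theorem exempts only this map from degree raising and proves all other Reedy axioms and elegance. *)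

(* Defs.v *)
From HB Require Import structures.
From mathcomp Require Import all_boot finmap boolp classical_sets cardinality.
Set Implicit Arguments.
Unset Strict Implicit.
Unset Printing Implicit Defensive.

Record category := Category {
  ob : Type;
  hom : ob -> ob -> Type;
  idm : forall a, hom a a;
  compm : forall a b c, hom b c -> hom a b -> hom a c;
  compm1 : forall a b (f : hom a b), compm f (idm a) = f;
  comp1m : forall a b (f : hom a b), compm (idm b) f = f;
  compmA : forall a b c d (h : hom c d) (g : hom b c) (f : hom a b),
    compm h (compm g f) = compm (compm h g) f
}.
Arguments idm {c} a : rename.

Record functor (C D : category) := Functor {
  fob :> ob C -> ob D;
  fmap : forall a b, hom a b -> hom (fob a) (fob b);
  fmap_id : forall a, fmap (idm a) = idm (fob a);
  fmap_comp : forall a b c (g : hom b c) (f : hom a b),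
    fmap (compm g f) = compm (fmap g) (fmap f)
}.

Lemma functor_eqP (C D : category) fo fm p1 p2 q1 q2 :
  @Functor C D fo fm p1 p2 = @Functor C D fo fm q1 q2.
Proof. by rewrite (Prop_irrelevance p1 q1) (Prop_irrelevance p2 q2). Qed.

Definition functor_id (C : category) : functor C C.
Proof. by apply: (@Functor C C id (fun _ _ f => f)). Defined.

Definition functor_comp (C D E : category) (G : functor D E) (F : functor C D) :
  functor C E.
Proof.
apply: (@Functor C E (fun a => G (F a)) (fun _ _ f => fmap G (fmap F f))).
- by move=> a; rewrite !fmap_id.
- by move=> a b c g f; rewrite !fmap_comp.
Defined.

Record presheaf (C : category) := Presheaf {
  psh :> ob C -> Type;
  res : forall a b, hom a b -> psh b -> psh a;
  res_id : forall a (x : psh a), res (idm a) x = x;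
  res_comp : forall a b c (g : hom b c) (f : hom a b) (x : psh c),
    res (compm g f) x = res f (res g x)
}.

Record psh_map (C : category) (P Q : presheaf C) := PshMap {
  pmap_at :> forall a, P a -> Q a;
  pmap_nat : forall a b (f : hom a b) (x : P b),
    pmap_at (res f x) = res f (pmap_at x)
}.

Definition psh_eq (C : category) (P Q : presheaf C) (u v : psh_map P Q) :=
  forall a (x : P a), u a x = v a x.

Definition psh_comp (C : category) (P Q T : presheaf C)
  (v : psh_map Q T) (u : psh_map P Q) : psh_map P T.
Proof.
apply: (@PshMap C P T (fun a x => v a (u a x))).
by move=> a b f x; rewrite !pmap_nat.
Defined.

Definition is_psh_pushout (C : category) (P A1 A2 B : presheaf C)
    (f1 : psh_map P A1) (f2 : psh_map P A2)
    (g1 : psh_map A1 B) (g2 : psh_map A2 B) :=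
  psh_eq (psh_comp g1 f1) (psh_comp g2 f2) /\
  forall (Q : presheaf C) (u1 : psh_map A1 Q) (u2 : psh_map A2 Q),
    psh_eq (psh_comp u1 f1) (psh_comp u2 f2) ->
    exists v : psh_map B Q,
      [/\ psh_eq (psh_comp v g1) u1,
          psh_eq (psh_comp v g2) u2 &
          forall v' : psh_map B Q,
            psh_eq (psh_comp v' g1) u1 -> psh_eq (psh_comp v' g2) u2 ->
            psh_eq v' v].

Definition yoneda (C : category) (r : ob C) : presheaf C.
Proof.
apply: (@Presheaf C (fun a => hom a r) (fun _ _ f x => compm x f)).
- by move=> a x; rewrite compm1.
- by move=> a b c g f x; rewrite compmA.
Defined.

Definition yoneda_map (C : category) (r s : ob C) (g : hom r s) :
  psh_map (yoneda r) (yoneda s).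
Proof.
apply: (@PshMap C (yoneda r) (yoneda s) (fun _ x => compm g x)).
by move=> a b f x; rewrite /= compmA.
Defined.

Definition hom_class (C : category) := forall a b : ob C, hom a b -> Prop.

Definition wide_subcategory (C : category) (P : hom_class C) :=
  (forall a, P a a (idm a)) /\
  (forall a b c (g : hom b c) (f : hom a b),
     P b c g -> P a b f -> P a c (compm g f)).

Inductive is_identity (C : category) : forall a b : ob C, hom a b -> Prop :=
  IsIdentity a : is_identity (@idm C a).

Record reedy_data := ReedyData {
  rcat : category;
  rplus : hom_class rcat;
  rminus : hom_class rcat;
  rdeg : ob rcat -> nat
}.

(* The axioms of a Reedy category, where however the morphisms of the direct
   subcategory that belong to [exc] are not required to raise the degree. *)
Definition is_reedy_except (R : reedy_data) (exc : hom_class (rcat R)) :=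
  [/\ wide_subcategory (@rplus R) /\ wide_subcategory (@rminus R),
      forall a b (f : @hom (rcat R) a b),
        rplus f -> ~ is_identity f -> ~ exc a b f -> rdeg a < rdeg b,
      forall a b (f : @hom (rcat R) a b),
        rminus f -> ~ is_identity f -> rdeg b < rdeg a &
      forall a b (f : @hom (rcat R) a b),
        exists! x : {c : ob (rcat R) & (hom a c * hom c b)%type},
          [/\ rminus (projT2 x).1, rplus (projT2 x).2 &
              f = compm (projT2 x).2 (projT2 x).1]].

Definition is_reedy (R : reedy_data) :=
  is_reedy_except (fun (a b : ob (rcat R)) (_ : hom a b) => False).

Definition elegant (R : reedy_data) :=
  forall (r a1 a2 : ob (rcat R)) (s1 : hom r a1) (s2 : hom r a2),
    rminus s1 -> rminus s2 ->
    exists (b : ob (rcat R)) (t1 : hom a1 b) (t2 : hom a2 b),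
      [/\ rminus t1, rminus t2, compm t1 s1 = compm t2 s2 &
          is_psh_pushout (yoneda_map s1) (yoneda_map s2)
                         (yoneda_map t1) (yoneda_map t2)].

Record operad := Operad {
  col : Type;
  op : Type;
  src : op -> seq col;
  tgt : op -> col;
  oid : col -> op;
  gam : forall (g : op) (gs : seq op), map tgt gs = src g -> op;
  src_id : forall c, src (oid c) = [:: c];
  tgt_id : forall c, tgt (oid c) = c;
  src_gam : forall g gs H, src (@gam g gs H) = flatten (map src gs);
  tgt_gam : forall g gs H, tgt (@gam g gs H) = tgt g;
  gam1l : forall g H, @gam (oid (tgt g)) [:: g] H = g;
  gam1r : forall g H, @gam g (map oid (src g)) H = g;
  (* [xs] lists the composable pairs (g_i; h_i1, ..., h_ik_i). *)
  gamA : forall g (xs : seq {x : op * seq op | map tgt x.2 = src x.1}) H K L,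
    @gam (@gam g [seq (sval x).1 | x <- xs] H)
         (flatten [seq (sval x).2 | x <- xs]) K
    = @gam g [seq gam (svalP x) | x <- xs] L
}.
Arguments gam {o g gs} H.

Record operad_map (O P : operad) := OperadMap {
  cmap : col O -> col P;
  omap :> op O -> op P;
  omap_src : forall g, src (omap g) = map cmap (src g);
  omap_tgt : forall g, tgt (omap g) = cmap (tgt g);
  omap_id : forall c, omap (oid c) = oid (cmap c);
  omap_gam : forall g gs (H : map (@tgt O) gs = src g)
    (K : map (@tgt P) (map omap gs) = src (omap g)),
    omap (gam H) = gam K
}.

Lemma operad_map_eqP (O P : operad) fc fo p1 p2 p3 p4 q1 q2 q3 q4 :
  @OperadMap O P fc fo p1 p2 p3 p4 = @OperadMap O P fc fo q1 q2 q3 q4.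
Proof.
by rewrite (Prop_irrelevance p1 q1) (Prop_irrelevance p2 q2)
           (Prop_irrelevance p3 q3) (Prop_irrelevance p4 q4).
Qed.

Definition operad_map_id (O : operad) : operad_map O O.
Proof.
apply: (@OperadMap O O id id) => // g; first by rewrite map_id.
move=> gs H; rewrite map_id => K.
by rewrite (Prop_irrelevance H K).
Defined.

Definition operad_map_comp (O P Q : operad)
  (Y : operad_map P Q) (X : operad_map O P) : operad_map O Q.
Proof.
apply: (@OperadMap O Q (fun c => cmap Y (cmap X c)) (fun g => Y (X g))).
- by move=> g; rewrite !omap_src -map_comp.
- by move=> g; rewrite !omap_tgt.
- by move=> c; rewrite !omap_id.
- move=> g gs H K.
  have K' : map (@tgt P) (map X gs) = src (X g).
    rewrite omap_src -H -!map_comp; apply: eq_map => h /=.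
    by rewrite omap_tgt.
  rewrite (omap_gam _ K').
  have eK : [seq Y (X g0) | g0 <- gs] = map Y (map X gs) by rewrite -map_comp.
  move: K; rewrite eK => K.
  exact: omap_gam.
Defined.

Record cat_action (C : category) (A : Type) := CatAction {
  mu : A -> ob C;
  act : forall x y, hom x y -> forall a : A, mu a = x -> A;
  mu_act : forall x y (f : hom x y) a H, mu (@act x y f a H) = y;
  act_id : forall x a H, @act x x (idm x) a H = a;
  act_comp : forall x y z (g : hom y z) (f : hom x y) a H K,
    @act x z (compm g f) a H = @act y z g (@act x y f a H) K
}.
Arguments act {C A} c {x y} f {a} H.

Record rooted_action := RootedAction {
  acat : category;
  aop : operad;
  aact :> cat_action acat (op aop);
  mu_gam : forall g gs (H : map (@tgt aop) gs = src g),
    mu aact (gam H) = mu aact g;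
  src_act : forall x y (f : hom x y) g (H : mu aact g = x),
    src (act aact f H) = src g
}.

Record ra_map (X Y : rooted_action) := RAMap {
  Xc :> functor (acat X) (acat Y);
  Xd : operad_map (aop X) (aop Y);
  ra_mu : forall g, mu Y (Xd g) = Xc (mu X g);
  ra_act : forall x y (f : hom x y) g (H : mu X g = x)
    (K : mu Y (Xd g) = Xc x),
    Xd (act X f H) = act Y (fmap Xc f) K
}.

Lemma ra_map_eqP (X Y : rooted_action) (f g : ra_map X Y) :
  Xc f = Xc g -> Xd f = Xd g -> f = g.
Proof.
case: f g => [fc fd p1 p2] [gc gd q1 q2] /= ec ed.
case: gc / ec q1 q2 => q1; case: gd / ed q1 => q1 q2.
by rewrite (Prop_irrelevance p1 q1) (Prop_irrelevance p2 q2).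
Qed.

Definition ra_id (X : rooted_action) : ra_map X X.
Proof.
apply: (@RAMap X X (functor_id _) (operad_map_id _)) => //=.
by move=> x y f g H K; rewrite (Prop_irrelevance H K).
Defined.

Definition ra_comp (X Y Z : rooted_action) (g : ra_map Y Z) (f : ra_map X Y) :
  ra_map X Z.
Proof.
apply: (@RAMap X Z (functor_comp (Xc g) (Xc f)) (operad_map_comp (Xd g) (Xd f))).
- by move=> h /=; rewrite !ra_mu.
- move=> x y u h H K /=.
  have K' : mu Y (Xd f h) = f x by rewrite ra_mu H.
  by rewrite (ra_act _ _ K'); apply: ra_act.
Defined.

(* The full subcategory of the category of rooted actions on the family [F]. *)
Definition full_ra (I : Type) (F : I -> rooted_action) : category.
Proof.
apply: (@Category I (fun i j => ra_map (F i) (F j)) (fun i => ra_id (F i))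
                  (fun i j k g f => ra_comp g f)).
- move=> i j f; apply: ra_map_eqP => /=.
    by case: (Xc f) => *; refine (functor_eqP _ _ _ _).
  by case: (Xd f) => *; refine (operad_map_eqP _ _ _ _ _ _ _ _).
- move=> i j f; apply: ra_map_eqP => /=.
    by case: (Xc f) => *; refine (functor_eqP _ _ _ _).
  by case: (Xd f) => *; refine (operad_map_eqP _ _ _ _ _ _ _ _).
- move=> i j k l h g f; apply: ra_map_eqP.
    by refine (functor_eqP _ _ _ _).
  by refine (operad_map_eqP _ _ _ _ _ _ _ _).
Defined.

(* [Leaf] is the tree with one edge and no vertices; [Node ts] has a root vertex
   whose inputs are, in order, the root edges of the trees [ts] (possibly none).
   Every planar isomorphism class has exactly one representative. *)
Inductive ptree := Leaf | Node of seq ptree.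

(* An edge of a tree is named by the sequence of input positions that leads to it
   from the root edge, which is [::].  A vertex is named by its output edge. *)
Definition epath := seq nat.

Fixpoint subtree (t : ptree) (p : epath) : option ptree :=
  match p, t with
  | [::], _ => Some t
  | i :: p', Leaf => None
  | i :: p', Node ts => if onth ts i is Some u then subtree u p' else None
  end.

(* [None] is the empty tree. *)
Definition subtree_at (S : option ptree) (p : epath) : option ptree :=
  if S is Some t then subtree t p else None.

Definition is_edge (S : option ptree) (p : epath) : bool :=
  if subtree_at S p is Some _ then true else false.
Definition is_leaf (S : option ptree) (p : epath) : bool :=
  if subtree_at S p is Some Leaf then true else false.
Definition is_vertex (S : option ptree) (p : epath) : bool :=
  if subtree_at S p is Some (Node _) then true else false.
Definition inputs (S : option ptree) (p : epath) : seq epath :=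
  if subtree_at S p is Some (Node ts) then [seq rcons p i | i <- iota 0 (size ts)]
  else [::].

Definition edge (S : option ptree) := {p : epath | is_edge S p}.

(* In O_(n,S) a color is either an edge of S or a pair (k, h), written [New h],
   where [h] is an operation of moment k - 1; a generator is either a vertex of S
   or an operation p_(k-1,k) . h, written [Push h].  As each step adjoins
   generators freely, operations are terms: [Id c] is the identity of [c], and
   [App g hs] is the composite of the generator [g] with the operations [hs].
   The well-formed terms are singled out by [wf] below. *)
Variant color_of (T : Type) := Edge of epath | New of T.
Variant gen_of (T : Type) := Vertex of epath | Push of T.
Arguments Edge {T} p : rename.
Arguments New {T} h : rename.
Arguments Vertex {T} p : rename.
Arguments Push {T} h : rename.

Inductive term := Id of color_of term | App of gen_of term & seq term.

Notation color := (color_of term).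
Notation gen := (gen_of term).

Section TermInd.
Variable P : term -> Prop.
Hypothesis P_ide : forall p, P (Id (Edge p)).
Hypothesis P_idn : forall h, P h -> P (Id (New h)).
Hypothesis P_vertex : forall p hs, foldr (fun h => and (P h)) True hs ->
  P (App (Vertex p) hs).
Hypothesis P_push : forall g hs, P g -> foldr (fun h => and (P h)) True hs ->
  P (App (Push g) hs).
Fixpoint term_ind' (h : term) : P h :=
  let fix all_ind hs : foldr (fun h => and (P h)) True hs :=
    match hs with
    | [::] => I
    | h :: hs' => conj (term_ind' h) (all_ind hs')
    end in
  match h with
  | Id (Edge p) => P_ide p
  | Id (New h) => P_idn (term_ind' h)
  | App (Vertex p) hs => P_vertex p (all_ind hs)
  | App (Push g) hs => P_push (term_ind' g) (all_ind hs)
  end.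
End TermInd.

Fixpoint term_encode (h : term) : GenTree.tree epath :=
  match h with
  | Id (Edge p) => GenTree.Node 0 [:: GenTree.Leaf p]
  | Id (New h) => GenTree.Node 1 [:: term_encode h]
  | App (Vertex p) hs =>
      GenTree.Node 2 (GenTree.Leaf p :: map term_encode hs)
  | App (Push g) hs => GenTree.Node 3 (term_encode g :: map term_encode hs)
  end.

Fixpoint term_decode (t : GenTree.tree epath) : term :=
  match t with
  | GenTree.Node 0 [:: GenTree.Leaf p] => Id (Edge p)
  | GenTree.Node 1 [:: t] => Id (New (term_decode t))
  | GenTree.Node 2 (GenTree.Leaf p :: ts) => App (Vertex p) (map term_decode ts)
  | GenTree.Node 3 (t :: ts) => App (Push (term_decode t)) (map term_decode ts)
  | _ => Id (Edge [::])
  end.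

Lemma term_encodeK : cancel term_encode term_decode.
Proof.
have mapK hs : foldr (fun h => and (term_decode (term_encode h) = h)) True hs ->
    map term_decode (map term_encode hs) = hs.
  by elim: hs => //= h hs IH [-> /IH ->].
elim/term_ind' => //= [h -> | p hs /mapK -> | g hs -> /mapK ->] //.
Qed.

HB.instance Definition _ := Countable.copy term (can_type term_encodeK).

Definition color_encode T (c : color_of T) : epath + T :=
  match c with Edge p => inl p | New h => inr h end.
Definition color_decode T (c : epath + T) : color_of T :=
  match c with inl p => Edge p | inr h => New h end.
Lemma color_encodeK T : cancel (@color_encode T) (@color_decode T).
Proof. by case. Qed.
HB.instance Definition _ (T : countType) :=
  Countable.copy (color_of T) (can_type (@color_encodeK T)).

Definition gen_encode T (c : gen_of T) : epath + T :=
  match c with Vertex p => inl p | Push h => inr h end.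
Definition gen_decode T (c : epath + T) : gen_of T :=
  match c with inl p => Vertex p | inr h => Push h end.
Lemma gen_encodeK T : cancel (@gen_encode T) (@gen_decode T).
Proof. by case. Qed.
HB.instance Definition _ (T : countType) :=
  Countable.copy (gen_of T) (can_type (@gen_encodeK T)).

Definition term_tgt (h : term) : color :=
  match h with
  | Id c => c
  | App (Vertex p) _ => Edge p
  | App (Push g) _ => New g
  end.

Fixpoint term_src (h : term) : seq color :=
  match h with
  | Id c => [:: c]
  | App _ hs => flatten (map term_src hs)
  end.

(* Objects of C_(n,S): [inl i] is the object i of [n], and [inr e] is *_e. *)
Definition moment := (nat + epath)%type.

Definition edge_moment (p : epath) : moment := if p is [::] then inl 0 else inr p.

Definition moment_succ (x : moment) : moment :=
  if x is inl k then inl k.+1 else x.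

Fixpoint term_moment (h : term) : moment :=
  match h with
  | Id (Edge p) | App (Vertex p) _ => edge_moment p
  | Id (New g) | App (Push g) _ => moment_succ (term_moment g)
  end.

(* [wf S n h]: [h] is an operation of O_(n,S).  The color [New h] and the
   generator [Push h] exist in O_(n,S) if, for some k < n, [h] is an operation of
   O_(k,S) of moment k; they have then moment k + 1. *)
Fixpoint wf (S : option ptree) (n : nat) (h : term) {struct h} : bool :=
  match h with
  | Id (Edge p) => is_edge S p
  | Id (New g) => if term_moment g is inl k then (k < n) && wf S k g else false
  | App (Vertex p) hs =>
      [&& is_vertex S p, map term_tgt hs == map Edge (inputs S p)
        & all (wf S n) hs]
  | App (Push g) hs =>
      [&& if term_moment g is inl k then (k < n) && wf S k g else false,
          map term_tgt hs == term_src g & all (wf S n) hs]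
  end.

Definition color_wf (S : option ptree) (n : nat) (c : color) : bool :=
  match c with
  | Edge p => is_edge S p
  | New g => if term_moment g is inl k then (k < n) && wf S k g else false
  end.

Definition gen_wf (S : option ptree) (n : nat) (g : gen) : bool :=
  match g with
  | Vertex p => is_vertex S p
  | Push g => if term_moment g is inl k then (k < n) && wf S k g else false
  end.

(* Plugs [gs], in order, into the inputs of [h]. *)
Fixpoint graft (h : term) (gs : seq term) : term :=
  match h with
  | Id c => head (Id c) gs
  | App g hs =>
      let fix grafts hs gs :=
        match hs with
        | [::] => [::]
        | h :: hs' =>
            let k := size (term_src h) in
            graft h (take k gs) :: grafts hs' (drop k gs)
        end in
      App g (grafts hs gs)
  end.

Fixpoint grafts (hs gs : seq term) :=
  match hs with
  | [::] => [::]
  | h :: hs' =>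
      let k := size (term_src h) in
      graft h (take k gs) :: grafts hs' (drop k gs)
  end.

Lemma graft_App g hs gs : graft (App g hs) gs = App g (grafts hs gs).
Proof. by []. Qed.

Lemma term_ind_simple (P : term -> Prop) :
  (forall c, P (Id c)) ->
  (forall g hs, foldr (fun h => and (P h)) True hs -> P (App g hs)) ->
  forall h, P h.
Proof.
move=> Pid Papp; elim/term_ind' => // [p hs|g hs _]; exact: Papp.
Qed.

Definition gtgt (g : gen) : color :=
  match g with Vertex p => Edge p | Push h => New h end.
Definition gsrc (S : option ptree) (g : gen) : seq color :=
  match g with Vertex p => map Edge (inputs S p) | Push h => term_src h end.

Lemma term_tgt_App g hs : term_tgt (App g hs) = gtgt g.
Proof. by case: g. Qed.

Lemma wf_Id S n c : wf S n (Id c) = color_wf S n c.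
Proof. by case: c. Qed.

Lemma wf_App S n g hs : wf S n (App g hs) =
  [&& gen_wf S n g, map term_tgt hs == gsrc S g & all (wf S n) hs].
Proof. by case: g. Qed.

Lemma src_term_wf S n h : wf S n h -> all (color_wf S n) (term_src h).
Proof.
elim/term_ind_simple: h => [c|g hs IH]; first by rewrite wf_Id /= andbT.
rewrite wf_App => /and3P[_ _] /=; elim: hs IH => //= h hs IH [Ph Phs].
by move=> /andP[/Ph hh /(IH Phs) hhs]; rewrite all_cat hh.
Qed.

Lemma tgt_term_wf S n h : wf S n h -> color_wf S n (term_tgt h).
Proof.
case: h => [c|g hs]; rewrite ?wf_Id ?wf_App => // /andP[].
case: g => [p|h] //=; rewrite /is_vertex /is_edge.
by case: (subtree_at S p) => // -[].
Qed.

Lemma graft_tgt h gs : map term_tgt gs = term_src h ->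
  term_tgt (graft h gs) = term_tgt h.
Proof.
case: h => [c|g hs]; last by rewrite graft_App !term_tgt_App.
by case: gs => [|g [|]] //= [->].
Qed.

Lemma split_tgt gs (s t : seq color) : map term_tgt gs = s ++ t ->
  map term_tgt (take (size s) gs) = s /\ map term_tgt (drop (size s) gs) = t.
Proof.
by rewrite map_take map_drop => ->; rewrite take_size_cat // drop_size_cat.
Qed.

Lemma graft_src h gs : map term_tgt gs = term_src h ->
  term_src (graft h gs) = flatten (map term_src gs).
Proof.
elim/term_ind_simple: h gs => [c|g hs IH] gs.
  by case: gs => [|g [|]] //= [_]; rewrite cats0.
rewrite graft_App /= => H; elim: hs IH gs H => [|h hs IH] /=; first by move=> _ [].
move=> [Ph /IH{}IH] gs /split_tgt[/Ph -> /IH ->].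
by rewrite -flatten_cat -map_cat cat_take_drop.
Qed.

Lemma grafts_tgt hs gs : map term_tgt gs = flatten (map term_src hs) ->
  map term_tgt (grafts hs gs) = map term_tgt hs.
Proof.
elim: hs gs => //= h hs IH gs /split_tgt[/graft_tgt -> /IH ->] //.
Qed.

Lemma graft_wf S n h gs : wf S n h -> all (wf S n) gs ->
  map term_tgt gs = term_src h -> wf S n (graft h gs).
Proof.
elim/term_ind_simple: h gs => [c|g hs IH] gs.
  by case: gs => [|g [|]] //= _; rewrite andbT.
rewrite graft_App !wf_App => /and3P[-> /eqP e hhs] hgs H /=.
apply/andP; split; first by rewrite grafts_tgt ?e.
elim: hs IH gs H hgs hhs {e} => //= h hs IH [Ph /IH{}IH] gs.
move=> /split_tgt[H1 H2] hgs /andP[hh hhs].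
move: hgs; rewrite -{1}(cat_take_drop (size (term_src h)) gs) all_cat.
by case/andP=> h1 h2; rewrite Ph //= IH.
Qed.

Lemma graft1 h : graft h (map Id (term_src h)) = h.
Proof.
elim/term_ind_simple: h => [c|g hs IH] //; rewrite graft_App /=; congr App.
elim: hs IH => //= h hs IH [Ph /IH{}IH].
by rewrite map_cat take_size_cat ?size_map // drop_size_cat ?size_map // Ph IH.
Qed.

Lemma graft_assoc h (xs : seq (term * seq term)) :
  map term_tgt (map fst xs) = term_src h ->
  (forall x, x \in xs -> map term_tgt x.2 = term_src x.1) ->
  graft (graft h (map fst xs)) (flatten (map snd xs))
  = graft h [seq graft x.1 x.2 | x <- xs].
Proof.
elim/term_ind_simple: h xs => [c|g hs IH] xs.
  case: xs => [|x [|]] //= _ H; by rewrite cats0.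
rewrite !graft_App /= => H K; congr App.
elim: hs IH xs H K => //= h hs IH [Ph /IH{}IH] xs H K.
set k := size (term_src h).
have [H1 H2] := split_tgt H.
move: H1 H2; rewrite -/k -!map_take -!map_drop => H1 H2.
have memt x : x \in take k xs -> map term_tgt x.2 = term_src x.1.
  by move=> /mem_take; apply: K.
have memd x : x \in drop k xs -> map term_tgt x.2 = term_src x.1.
  by move=> /mem_drop; apply: K.
have e : size (term_src (graft h [seq i.1 | i <- take k xs]))
       = size (flatten (map snd (take k xs))).
  rewrite graft_src // !size_flatten /shape -!map_comp; congr sumn.
  by apply/eq_in_map => x /memt /= <-; rewrite size_map.
have E : flatten (map snd xs) =
   flatten (map snd (take k xs)) ++ flatten (map snd (drop k xs)).
  by rewrite -flatten_cat -map_cat cat_take_drop.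
by rewrite -Ph // -IH // E e take_size_cat // drop_size_cat.
Qed.

Section OperadO.
Variables (n : nat) (S : option ptree).

Definition O_col := {c : color | color_wf S n c}.
Definition O_op := {h : term | wf S n h}.

(* [pmap insub] views the elements of a sequence as elements of a subtype. *)
Definition O_src (h : O_op) : seq O_col := pmap insub (term_src (val h)).
Definition O_tgt (h : O_op) : O_col := Sub (term_tgt (val h)) (tgt_term_wf (valP h)).

Lemma id_term_wf (c : O_col) : wf S n (Id (val c)).
Proof. by rewrite wf_Id (valP c). Qed.
Definition O_id (c : O_col) : O_op := Sub (Id (val c)) (id_term_wf c).

Lemma O_srcE h : map val (O_src h) = term_src (val h).
Proof.
rewrite /O_src (pmap_filter (insubK _)); apply/all_filterP.
rewrite (eq_all (isSome_insub _)); exact: src_term_wf (valP h).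
Qed.

Lemma O_tgtE (gs : seq O_op) : map val (map O_tgt gs) = map term_tgt (map val gs).
Proof. by rewrite -!map_comp. Qed.

Lemma O_wf_all (gs : seq O_op) : all (wf S n) (map val gs).
Proof. by elim: gs => //= g gs ->; rewrite (valP g). Qed.

Lemma O_composable g (gs : seq O_op) : map O_tgt gs = O_src g ->
  map term_tgt (map val gs) = term_src (val g).
Proof. by move=> H; rewrite -O_tgtE H O_srcE. Qed.

Definition O_gam (g : O_op) (gs : seq O_op) (H : map O_tgt gs = O_src g) : O_op :=
  Sub (graft (val g) (map val gs))
      (graft_wf (valP g) (O_wf_all gs) (O_composable H)).

Let vinj : injective (map (val : O_col -> color)) := inj_map val_inj.

Definition Oper : operad.
Proof.
apply: (@Operad O_col O_op O_src O_tgt O_id O_gam).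
- by move=> c; apply: vinj; rewrite O_srcE.
- by move=> c; apply: val_inj.
- move=> g gs H; apply: vinj.
  rewrite O_srcE /= (graft_src (O_composable H)) map_flatten -!map_comp.
  by congr flatten; apply: eq_map => h /=; rewrite O_srcE.
- by move=> g gs H; apply: val_inj => /=; rewrite (graft_tgt (O_composable H)).
- by move=> g H; apply: val_inj.
- move=> g H; apply: val_inj => /=; rewrite -[RHS]graft1; congr graft.
  by rewrite -O_srcE -!map_comp.
- move=> g xs H K L; apply: val_inj => /=.
  pose ys := [seq (val (sval x).1, map val (sval x).2) | x <- xs].
  have e1 : map val [seq (sval x).1 | x <- xs] = map fst ys by rewrite -!map_comp.
  have e2 : map val (flatten [seq (sval x).2 | x <- xs]) = flatten (map snd ys).
    by rewrite map_flatten -!map_comp.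
  have e3 : map val [seq O_gam (svalP x) | x <- xs] = [seq graft y.1 y.2 | y <- ys].
    by rewrite -!map_comp.
  rewrite e1 e2 e3; apply: graft_assoc; first by rewrite -e1 (O_composable H).
  elim: xs @ys {H K L e1 e2 e3} => //= x xs IH y; rewrite inE => /orP[/eqP->|].
    exact: O_composable (svalP x).
  exact: IH.
Defined.

End OperadO.

Definition moment_wf (S : option ptree) (n : nat) (x : moment) : bool :=
  match x with inl i => i <= n | inr p => is_edge S p && (p != [::]) end.

Definition moment_le (x y : moment) : bool :=
  match x, y with
  | inl i, inl j => i <= j
  | inr p, inr q => p == q
  | _, _ => false
  end.

Lemma moment_le_refl x : moment_le x x.
Proof. by case: x => [i|p] /=. Qed.

Lemma moment_le_trans y x z : moment_le y z -> moment_le x y -> moment_le x z.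
Proof.
case: x y z => [i|p] [j|q] [k|r] //=; first by move=> h /leq_trans; apply.
by move=> /eqP <-.
Qed.

Definition Ccat (n : nat) (S : option ptree) : category.
Proof.
apply: (@Category {x : moment | moment_wf S n x}
  (fun x y => moment_le (val x) (val y))
  (fun x => moment_le_refl (val x))
  (fun x y z => @moment_le_trans (val y) (val x) (val z))).
- by move=> a b f; apply: bool_irrelevance.
- by move=> a b f; apply: bool_irrelevance.
- by move=> a b c d h g f; apply: bool_irrelevance.
Defined.

Definition color_moment (c : color) : moment :=
  match c with Edge p => edge_moment p | New h => moment_succ (term_moment h) end.

Lemma term_moment_tgt h : term_moment h = color_moment (term_tgt h).
Proof. by case: h => [[]|[]]. Qed.

Lemma edge_moment_wf S n p : is_edge S p -> moment_wf S n (edge_moment p).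
Proof. by case: p => //= i p ->. Qed.

Lemma vertex_edge S p : is_vertex S p -> is_edge S p.
Proof. by rewrite /is_vertex /is_edge; case: subtree_at => // -[]. Qed.

Lemma color_moment_wf S n c : color_wf S n c -> moment_wf S n (color_moment c).
Proof.
case: c => [p|h] /=; first exact: edge_moment_wf.
by case: (term_moment h) => //= k /andP[].
Qed.

Lemma term_moment_wf S n h : wf S n h -> moment_wf S n (term_moment h).
Proof. by rewrite term_moment_tgt => /tgt_term_wf/color_moment_wf. Qed.

Lemma inputs_moment S p c : c \in map Edge (inputs S p) ->
  exists q, color_moment c = inr q.
Proof.
case/mapP=> q; rewrite /inputs; case: subtree_at => // -[//|ts].
by case/mapP=> i _ -> ->; case: p => [|j p] /=; eexists.
Qed.

Definition bounded (x : moment) (k : nat) := forall j, x = inl j -> j <= k.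

Lemma src_moment S n h c : wf S n h -> c \in term_src h ->
  forall j, color_moment c = inl j ->
  exists2 i, term_moment h = inl i & j <= i.
Proof.
suff all_src (hs : seq term) m (s : seq color) :
    foldr (fun h => and (forall m c, wf S m h -> c \in term_src h ->
      forall j, color_moment c = inl j ->
      exists2 i, term_moment h = inl i & j <= i)) True hs ->
    all (wf S m) hs -> map term_tgt hs = s ->
    forall c j, c \in flatten (map term_src hs) -> color_moment c = inl j ->
    exists c', exists2 i, c' \in s & color_moment c' = inl i /\ j <= i.
  elim/term_ind': h n c => [p|h IH|p hs IH|g hs IHg IH] n c.
  - by move=> _; rewrite inE => /eqP-> j /= ->; exists j.
  - by move=> _; rewrite inE => /eqP-> j /= ->; exists j.
  - case/and3P=> _ /eqP e hhs hc j ej.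
    have [c' [i /inputs_moment[q ->] []]] // := all_src _ _ _ IH hhs e _ _ hc ej.
  - case/and3P=> hg /eqP e hhs hc j ej.
    have [c' [i hc' [ei ji]]] := all_src _ _ _ IH hhs e _ _ hc ej.
    move: hg; case eg: (term_moment g) => [k|//] /andP[_ hg].
    have [i' ei' ii'] := IHg _ _ hg hc' _ ei.
    rewrite /= ei'; exists i'.+1 => //; exact: leq_trans ji (leqW ii').
move=> {h n c} + + <- {s}; elim: hs => //= h hs IH [Ph /IH{}IH] /andP[hh /IH{}IH] c' j.
rewrite mem_cat => /orP[hc ej|hc ej].
  have [i ei ji] := Ph _ _ hh hc _ ej.
  by exists (term_tgt h); exists i; rewrite ?inE ?eqxx // -term_moment_tgt.
have [d [i hd [ei ji]]] := IH _ _ hc ej.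
by exists d; exists i; rewrite ?inE ?hd ?orbT.
Qed.

Lemma wf_level S n k h : wf S n h -> bounded (term_moment h) k -> wf S k h.
Proof.
suff all_wf (hs : seq term) (s : seq color) :
    foldr (fun h => and (wf S n h -> bounded (term_moment h) k -> wf S k h))
      True hs ->
    all (wf S n) hs -> map term_tgt hs = s ->
    (forall c, c \in s -> bounded (color_moment c) k) -> all (wf S k) hs.
  elim/term_ind': h => [p|h IH|p hs IH|g hs IHg IH] //=.
  - case eh: (term_moment h) => [i|//] /andP[_ ->] b.
    by rewrite andbT; apply: b.
  - case/and3P=> -> /eqP e hhs _; rewrite e eqxx /=.
    by apply: all_wf IH hhs e _ => c /inputs_moment[q ->].
  - case/and3P=> + /eqP e hhs; rewrite e eqxx.
    case eg: (term_moment g) => [i|//] /andP[_ hg] b.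
    have ik : i < k by apply: b.
    rewrite ik hg /=; apply: all_wf IH hhs e _ => c hc j ej.
    have [i1 ei1 ji] := src_moment hg hc ej.
    have [e1] : inl i = inl i1 :> moment by rewrite -eg.
    by apply: leq_trans ji _; rewrite -e1 ltnW.
move=> {h} + + <- {s}; elim: hs => //= h hs IH [Ph Phs] /andP[hh hhs] b.
rewrite Ph //=; last by rewrite term_moment_tgt; apply: b; rewrite inE eqxx.
by apply: IH => // c hc; apply: b; rewrite inE hc orbT.
Qed.

(* The operation p_(k,k+1) . h, for k the moment of [h]. *)
Definition push (h : term) : term := App (Push h) (map Id (term_src h)).

Lemma push_src h : term_src (push h) = term_src h.
Proof. by rewrite /= -map_comp /comp /= flatten_map1 map_id. Qed.

Lemma push_wf S n h k : wf S n h -> term_moment h = inl k -> k < n ->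
  wf S n (push h).
Proof.
move=> hh ek kn; rewrite /push /= ek kn /=.
rewrite (wf_level hh) /=; last by rewrite ek => j [<-].
rewrite -map_comp map_id_in // eqxx /= all_map.
apply: sub_all (src_term_wf hh) => c /=.
by rewrite -/(wf S n (Id c)) wf_Id.
Qed.

Definition raw_act (x y : moment) (h : term) : term :=
  match x, y with inl i, inl j => iter (j - i) push h | _, _ => h end.

Lemma iter_push S n h k d : wf S n h -> term_moment h = inl k -> k + d <= n ->
  wf S n (iter d push h) /\ term_moment (iter d push h) = inl (k + d).
Proof.
move=> hh ek; elim: d => [|d IH] le; first by rewrite addn0.
have [h1 e1] := IH (ltnW (leq_trans (eq_leq (esym (addnS k d))) le)).
by split; [apply: push_wf h1 e1 _; rewrite -addnS | rewrite /= e1 addnS].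
Qed.

Lemma iter_push_src h d : term_src (iter d push h) = term_src h.
Proof. by elim: d => // d IH; rewrite iterS push_src. Qed.

Lemma raw_actP S n x y h : wf S n h -> moment_le x y -> moment_wf S n y ->
  term_moment h = x ->
  wf S n (raw_act x y h) /\ term_moment (raw_act x y h) = y.
Proof.
case: x y => [i|p] [j|q] //= hh; last by move=> /eqP->.
move=> ij jn e; rewrite -{3}(subnKC ij); apply: iter_push => //.
by rewrite subnKC.
Qed.

Lemma raw_act_comp x y z h : moment_le y z -> moment_le x y ->
  raw_act x z h = raw_act y z (raw_act x y h).
Proof.
case: x y z => [i|p] [j|q] [k|r] //= jk ij.
by rewrite -iterD addnBA // subnK.
Qed.

Lemma raw_act_src x y h : term_src (raw_act x y h) = term_src h.
Proof. by case: x y => [i|p] [j|q] //=; rewrite iter_push_src. Qed.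

Section RootedAction.
Variables (n : nat) (S : option ptree).

Definition O_mu (h : op (Oper n S)) : ob (Ccat n S) :=
  Sub (term_moment (val h)) (term_moment_wf (valP h)).

Lemma O_act_wf (x y : ob (Ccat n S)) (f : hom x y) (h : op (Oper n S)) :
  O_mu h = x -> wf S n (raw_act (val x) (val y) (val h)).
Proof.
move=> e; have ex : term_moment (val h) = val x by rewrite -e.
by case: (raw_actP (valP h) f (valP y) ex).
Qed.

Definition O_act (x y : ob (Ccat n S)) (f : hom x y) (h : op (Oper n S))
  (H : O_mu h = x) : op (Oper n S) :=
  Sub (raw_act (val x) (val y) (val h)) (O_act_wf f H).

Definition Oaction : cat_action (Ccat n S) (op (Oper n S)).
Proof.
apply: (@CatAction _ _ O_mu O_act).
- move=> x y f a H; apply: val_inj => /=.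
  have ex : term_moment (val a) = val x by rewrite -H.
  by case: (raw_actP (valP a) f (valP y) ex).
- move=> x a H; apply: val_inj => /=.
  by case: (sval x) => //= i; rewrite subnn.
- move=> x y z g f a H K; apply: val_inj => /=.
  exact: raw_act_comp g f.
Defined.

Definition RA : rooted_action.
Proof.
apply: (@RootedAction (Ccat n S) (Oper n S) Oaction).
- move=> g gs H; apply: val_inj => /=.
  by rewrite !term_moment_tgt (graft_tgt (O_composable H)).
- move=> x y f g H; apply: (inj_map val_inj); rewrite !O_srcE /=.
  exact: raw_act_src.
Defined.

End RootedAction.

(* The object (n, Some S) stands for [n o S], and (n, None) for [n o empty]. *)
Definition DeltaOmega : category :=
  full_ra (fun X : nat * option ptree => RA X.1 X.2).

Definition num (n : nat) (S : option ptree) (i : 'I_n.+1) : ob (Ccat n S) :=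
  Sub (inl (val i) : moment) (leq_ord i : moment_wf S n (inl (val i))).

Definition edge_col (n : nat) (S : option ptree) (e : edge S) : col (Oper n S) :=
  Sub (Edge (val e) : color) (valP e : color_wf S n (Edge (val e))).

Definition DOalpha (a b : ob DeltaOmega) (X : hom a b) (i : 'I_(a.1).+1) :
  ob (Ccat b.1 b.2) := Xc X (num a.2 i).

(* The effect on colors of the restriction of X^d to O_(0,S), whose colors are the
   edges of S. *)
Definition DObeta (a b : ob DeltaOmega) (X : hom a b) (e : edge a.2) :
  col (Oper b.1 b.2) := cmap (Xd X) (edge_col a.1 e).

Definition DOplus : hom_class DeltaOmega := fun a b X =>
  injective (@DOalpha a b X) /\ injective (@DObeta a b X).

Definition DOminus : hom_class DeltaOmega := fun a b X =>
  [/\ forall j : 'I_(b.1).+1, exists i, @DOalpha a b X i = num b.2 j,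
      forall c : col (Oper b.1 b.2),
        exists c' : col (Oper a.1 a.2), cmap (Xd X) c' = c &
      forall e : edge a.2, is_leaf a.2 (val e) ->
        exists2 e' : edge b.2, is_leaf b.2 (val e') &
          @DObeta a b X e = edge_col b.1 e'].

(* The set of generators is finite, so its [fset_set] is not the default value. *)
Definition DOdeg (a : ob DeltaOmega) : nat :=
  a.1 + #|` fset_set [set g : gen | gen_wf a.2 a.1 g]%classic |.

Definition DeltaOmega_reedy : reedy_data := ReedyData DOplus DOminus DOdeg.

(* The map [0 o empty] -> [0 o Leaf], the only one of the direct subcategory that
   is not an identity and does not raise the degree: both degrees are 0. *)
Definition degree_exception : hom_class DeltaOmega := fun a b _ =>
  a = (0, None) /\ b = (0, Some Leaf).

Lemma wf_empty n h : wf None n h = false.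
Proof.
elim/term_ind': h n => [p|h IH|p hs _|g hs IH _] n //=;
  by case: (term_moment _) => // k; rewrite IH andbF.
Qed.

Lemma gen_wf_empty n g : gen_wf None n g = false.
Proof.
by case: g => [p|g] //=; case: (term_moment g) => // k; rewrite wf_empty andbF.
Qed.

Lemma color_wf_empty n c : color_wf None n c = false.
Proof. by rewrite -wf_Id wf_empty. Qed.

Lemma DOdeg_empty n : DOdeg (n, None) = n.
Proof.
rewrite /DOdeg /= (_ : [set g | _]%classic = set0) ?fset_set0 ?cardfs0 ?addn0 //.
by apply/seteqP; split => g //=; rewrite gen_wf_empty.
Qed.

Lemma DOdeg_leaf : DOdeg (0, Some Leaf) = 0.
Proof.
rewrite /DOdeg /= (_ : [set g | _]%classic = set0) ?fset_set0 ?cardfs0 //.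
apply/seteqP; split => // -[[|i p]|g] //=.
by case: (term_moment g).
Qed.

Lemma no_op_empty n : op (Oper n None) -> False.
Proof. by case=> h; rewrite wf_empty. Qed.

Lemma no_col_empty n : col (Oper n None) -> False.
Proof. by case=> c; rewrite color_wf_empty. Qed.

Definition exception_functor : functor (Ccat 0 None) (Ccat 0 (Some Leaf)).
Proof.
apply: (@Functor _ _ (fun=> num (Some Leaf) ord0) (fun _ _ _ => idm _)) => //.
by move=> a b c g f; apply: bool_irrelevance.
Defined.

Definition exception_operad_map : operad_map (Oper 0 None) (Oper 0 (Some Leaf)).
Proof.
apply: (@OperadMap _ _ (fun c => False_rect _ (no_col_empty c))
                       (fun h => False_rect _ (no_op_empty h))).
- by move=> g; case: (no_op_empty g).
- by move=> g; case: (no_op_empty g).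
- by move=> c; case: (no_col_empty c).
- by move=> g; case: (no_op_empty g).
Defined.

Definition exception_map :
  @hom (rcat DeltaOmega_reedy) (0, None) (0, Some Leaf).
Proof.
apply: (@RAMap (RA 0 None) (RA 0 (Some Leaf))
          exception_functor exception_operad_map) => [g|x y f g].
- by case: (no_op_empty g).
- by case: (no_op_empty g).
Defined.

(* Hence [is_reedy_except degree_exception], and not [is_reedy], is the Reedy
   property that can hold for the degree n + |gen(n,S)|. *)
Lemma DeltaOmega_not_reedy : ~ is_reedy DeltaOmega_reedy.
Proof.
case=> _ /(_ _ _ exception_map) + _ _; rewrite /= DOdeg_empty DOdeg_leaf ltnn.
move=> raise; suff: false by []; apply: raise => //.
- split=> [i j _|[p ep]]; last by [].
  by rewrite !ord1.
- move=> H.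
  suff: forall a b (f : @hom DeltaOmega a b), is_identity f -> a = b.
    by move=> /(_ _ _ _ H).
  by move=> a b f [].
Qed.

(* Main.v *)
From mathcomp Require Import all_boot finmap boolp classical_sets cardinality.
From mathcomp Require Import zify.
Require Import Defs.
Set Implicit Arguments.
Unset Strict Implicit.
Unset Printing Implicit Defensive.

Notation color := (color_of term).
Notation gen := (gen_of term).

(** Two kinds of degeneracies carry the proof: merging two consecutive levels i
    and i + 1 of [n], and collapsing a vertex with exactly one input of the
    planar tree.  Each has a section inside the category.

    The operads O_(n,S) are thin: an operation is determined by its inputs and
    its output ([operad_thin]).  The inputs of an operation are either a single
    color or edges in disjoint branches of the tree ([src_incomparable]), so the
    list of inputs of a composite shows how it is distributed over the factors.
    Hence a map of rooted actions is determined by what it does to the levels of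
    [n] and to the edges of the tree ([ra_map_ext]), and identities between
    degeneracies and sections become identities between functions on numbers
    and on paths.

    The relation that c is an input of an operation with output d is a partial
    order on colors, preserved by every map, and so is incomparability.  It
    follows that a map which is not direct identifies two consecutive levels or
    the two edges at a unary vertex ([not_plus]), that is, factors through an
    elementary degeneracy ([elementary_factor]).  A direct map is injective on
    all colors ([plus_col_im]) and sends different generators to operations with
    different outermost generators, so the degree does not drop; if it stays the
    same, every generator is hit, and an induction over the tree shows
    that the map is an identity or the map from the empty operad to the tree
    with one edge ([plus_degree_eq]).  An inverse map does not raise the degree,
    since generators can be lifted along it ([minus_degree]).  In particular a
    map that is both direct and inverse is an identity, and the section of an
    elementary degeneracy, being direct, shows that the degeneracy lowers the
    degree.

    The rest is formal ([elegant_criterion]).  Factorizations are obtained by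
    splitting off elementary degeneracies, and are unique because the direct
    part is injective, so that all of them split off the same degeneracies.  Two
    elementary degeneracies with the same source fit into a square with
    compatible sections ([elementary_square]).  Such a square is a pushout for
    equational reasons, so the Yoneda functor preserves it; pushouts of
    arbitrary inverse maps are pasted from these squares by induction on the
    degree. *)

(** * A criterion for elegance: splitting off one degeneracy at a time *)

Section Pushouts.
Variable C : category.

Definition yoneda_pushout (r a1 a2 b : ob C) (s1 : hom r a1) (s2 : hom r a2)
    (t1 : hom a1 b) (t2 : hom a2 b) :=
  is_psh_pushout (yoneda_map s1) (yoneda_map s2) (yoneda_map t1) (yoneda_map t2).

Lemma pushout_comm (r a1 a2 b : ob C) (s1 : hom r a1) (s2 : hom r a2)
    (t1 : hom a1 b) (t2 : hom a2 b) :
  yoneda_pushout s1 s2 t1 t2 -> compm t1 s1 = compm t2 s2.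
Proof. by case=> /(_ _ (idm r)) /=; rewrite !compm1. Qed.

Lemma pushout_sym (r a1 a2 b : ob C) (s1 : hom r a1) (s2 : hom r a2)
    (t1 : hom a1 b) (t2 : hom a2 b) :
  yoneda_pushout s1 s2 t1 t2 -> yoneda_pushout s2 s1 t2 t1.
Proof.
case=> comm univ; split=> [a x|Q u1 u2 e]; first by rewrite comm.
have [|v [v1 v2 vu]] := univ Q u2 u1; first by move=> a x; rewrite e.
by exists v; split=> // v' ? ?; apply: vu.
Qed.

Lemma pushout_idm (r a : ob C) (s : hom r a) :
  yoneda_pushout s (idm r) (idm a) s.
Proof.
split=> [c x|Q u1 u2 e] /=; first by rewrite !comp1m.
exists u1; split=> [c x|c x|v' h1 _ c x] /=; rewrite ?comp1m //.
  by rewrite [LHS]e /= comp1m.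
by rewrite -h1 /= comp1m.
Qed.

Lemma pushout_paste (r a1 a1' a2 b c : ob C) (s1 : hom r a1) (s2 : hom r a2)
    (t1 : hom a1 b) (t2 : hom a2 b)
    (s1' : hom a1 a1') (u : hom a1' c) (w : hom b c) :
  yoneda_pushout s1 s2 t1 t2 -> yoneda_pushout s1' t1 u w ->
  yoneda_pushout (compm s1' s1) s2 u (compm w t2).
Proof.
move=> po1 po2; have e1 := pushout_comm po1; have e2 := pushout_comm po2.
split=> [d x /=|Q v1 v2 e].
  by rewrite -(compmA w) (compmA t2) -e1 -(compmA t1) (compmA w) -e2 -!compmA.
have [|k [k1 k2 _]] := po1.2 Q (psh_comp v1 (yoneda_map s1')) v2.
  by move=> d x; rewrite -e /= compmA.
have [|l [l1 l2 lu]] := po2.2 Q v1 k; first by move=> d x; rewrite k1.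
exists l; split=> // [d x|l' h1 h2].
  by rewrite -k2 /= -compmA; exact: l2.
apply: lu => // d x.
have [k' [_ _ ku]] := po1.2 Q (psh_comp v1 (yoneda_map s1')) v2
  (fun d x => etrans (etrans (congr1 (v1 d) (compmA _ _ _)) (e d x)) erefl).
rewrite (ku k) //; apply: (ku (psh_comp l' (yoneda_map w))) => {}d {}x.
  rewrite -[RHS]/(v1 d (compm s1' x)) -h1 /= !compmA; congr (l' d (compm _ x)).
  exact: esym e2.
by rewrite -h2 /= compmA.
Qed.

(** The sections give the map out of the pushout explicitly, as the second leg
    composed with [e2]; only equations are used, so the square would remain a
    pushout under any functor. *)
Lemma pushout_split (r a1 a2 b : ob C) (s1 : hom r a1) (s2 : hom r a2)
    (t1 : hom a1 b) (t2 : hom a2 b)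
    (d1 : hom a1 r) (d2 : hom a2 r) (e2 : hom b a2) :
  compm s1 d1 = idm a1 -> compm s2 d2 = idm a2 -> compm t2 e2 = idm b ->
  compm t1 s1 = compm t2 s2 -> compm s2 d1 = compm e2 t1 ->
  yoneda_pushout s1 s2 t1 t2.
Proof.
move=> sd1 sd2 te ts sdet.
split=> [c x|Q u1 u2 e] /=; first by rewrite !compmA ts.
pose v := psh_comp u2 (yoneda_map e2).
have v1 : psh_eq (psh_comp v (yoneda_map t1)) u1.
  move=> c x /=; rewrite compmA -sdet -compmA.
  by rewrite -[LHS](e c (compm d1 x)) /= compmA sd1 comp1m.
exists v; split=> // [c x|v' h1 h2 c x].
  have -> : x = compm s2 (compm d2 x) by rewrite compmA sd2 comp1m.
  rewrite -[RHS]e -[RHS]/(u1 c (compm s1 (compm d2 x))) -v1.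
  by rewrite -[LHS]/(v c (compm t2 (compm s2 (compm d2 x)))) compmA -ts -compmA.
by rewrite -{1}[x]comp1m -te -compmA; exact: h2.
Qed.

End Pushouts.

Section Criterion.
Variables (D : reedy_data) (exc : hom_class (rcat D)).
Notation C := (rcat D).
(* The second argument is a chosen section of the first. *)
Variable elementary : forall r a : ob C, hom r a -> hom a r -> Prop.

(** The section of the first leg descends along the second leg to a section of
    [t2].  This is asymmetric: a span may have such a square in only one of the
    two orders. *)
Definition split_square (r a1 a2 : ob C) (s1 : hom r a1) (d1 : hom a1 r)
    (s2 : hom r a2) :=
  exists (b : ob C) (t1 : hom a1 b) (t2 : hom a2 b) (e2 : hom b a2),
    [/\ rminus t1, rminus t2, compm t2 e2 = idm b,
        compm t1 s1 = compm t2 s2 & compm s2 d1 = compm e2 t1].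

Hypothesis plus_wide : wide_subcategory (@rplus D).
Hypothesis minus_wide : wide_subcategory (@rminus D).
Hypothesis plus_cancel : forall (a b c : ob C) (g : hom b c) (f : hom a b),
  rplus (compm g f) -> rplus f.
Hypothesis plus_deg : forall (a b : ob C) (f : hom a b),
  rplus f -> ~ is_identity f -> ~ exc f -> rdeg a < rdeg b.
Hypothesis plus_minus : forall (a b : ob C) (f : hom a b),
  rplus f -> rminus f -> is_identity f.
Hypothesis minus_deg : forall (a b : ob C) (f : hom a b),
  rminus f -> rdeg b <= rdeg a.
Hypothesis elementary_deg : forall (r a : ob C) (e : hom r a) (d : hom a r),
  elementary e d -> rdeg a < rdeg r.
Hypothesis elementary_minus : forall (r a : ob C) (e : hom r a) (d : hom a r),
  elementary e d -> rminus e.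
Hypothesis elementary_split : forall (r a : ob C) (e : hom r a) (d : hom a r),
  elementary e d -> compm e d = idm a.
Hypothesis elementary_factor : forall (r b : ob C) (f : hom r b), ~ rplus f ->
  exists (a : ob C) (e : hom r a) (d : hom a r),
    elementary e d /\ f = compm (compm f d) e.
Hypothesis minus_cancel : forall (r a b : ob C) (e : hom r a) (d : hom a r)
  (f : hom a b), elementary e d -> rminus (compm f e) -> rminus f.
(* The direct map u is injective, so s identifies all that u s identifies. *)
Hypothesis elementary_kernel : forall (r a b c : ob C) (e : hom r a) (d : hom a r)
  (s : hom r b) (u : hom b c), elementary e d -> rminus s -> rplus u ->
  compm u (compm (compm s d) e) = compm u s -> compm (compm s d) e = s.
Hypothesis elementary_square : forall (r a1 a2 : ob C) (e1 : hom r a1) (d1 : hom a1 r)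
  (e2 : hom r a2) (d2 : hom a2 r), elementary e1 d1 -> elementary e2 d2 ->
  split_square e1 d1 e2 \/ split_square e2 d2 e1.

Lemma minus_elem_factor (r b : ob C) (s : hom r b) :
  rminus s -> ~ is_identity s ->
  exists (a : ob C) (e : hom r a) (d : hom a r),
    [/\ elementary e d, s = compm (compm s d) e & rminus (compm s d)].
Proof.
move=> sm sni; have [sp|sp] := pselect (rplus s); first by case: sni; apply: plus_minus.
have [a [e [d [ed es]]]] := elementary_factor sp.
by exists a, e, d; split=> //; apply: (minus_cancel ed); rewrite -es.
Qed.

Lemma elementary_pushout (r a1 a2 : ob C) (e1 : hom r a1) (d1 : hom a1 r)
    (e2 : hom r a2) (d2 : hom a2 r) : elementary e1 d1 -> elementary e2 d2 ->
  exists (b : ob C) (t1 : hom a1 b) (t2 : hom a2 b),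
    [/\ rminus t1, rminus t2 & yoneda_pushout e1 e2 t1 t2].
Proof.
move=> ed1 ed2; have sd1 := elementary_split ed1; have sd2 := elementary_split ed2.
case: (elementary_square ed1 ed2) => -[b [t1 [t2 [k [m1 m2 tk comm sq]]]]].
  by exists b, t1, t2; split=> //; apply: pushout_split sd1 sd2 tk comm sq.
exists b, t2, t1; split=> //; apply: pushout_sym.
exact: (pushout_split sd2 sd1 tk comm sq).
Qed.

(** As in Newman's lemma: an elementary degeneracy is split off each leg, the two
    are completed to a square, and the three spans that remain start at objects
    of lower degree. *)
Lemma minus_pushout (r a1 a2 : ob C) (s1 : hom r a1) (s2 : hom r a2) :
  rminus s1 -> rminus s2 ->
  exists (b : ob C) (t1 : hom a1 b) (t2 : hom a2 b),
    [/\ rminus t1, rminus t2 & yoneda_pushout s1 s2 t1 t2].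
Proof.
have [N] := ubnP (rdeg r); elim: N r a1 a2 s1 s2 => // N IH r a1 a2 s1 s2 rN m1 m2.
have [i1|n1] := pselect (is_identity s1).
  case: r a1 s1 / i1 s2 rN m1 m2 => r s2 _ _ m2; exists a2, s2, (idm a2).
  split=> //; first exact: minus_wide.1.
  by apply: pushout_sym; exact: pushout_idm.
have [i2|n2] := pselect (is_identity s2).
  case: r a2 s2 / i2 s1 rN m1 m2 {n1} => r s1 _ m1 _; exists a1, (idm a1), s1.
  split=> //; first exact: minus_wide.1.
  exact: pushout_idm.
have [x1 [e1 [d1 [ed1 es1 sm1]]]] := minus_elem_factor m1 n1.
have [x2 [e2 [d2 [ed2 es2 sm2]]]] := minus_elem_factor m2 n2.
have [y [t1 [t2 [tm1 tm2 po]]]] := elementary_pushout ed1 ed2.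
have x1N : rdeg x1 < N by apply: leq_trans (elementary_deg ed1) _.
have x2N : rdeg x2 < N by apply: leq_trans (elementary_deg ed2) _.
have yN : rdeg y < N by apply: leq_ltn_trans x1N; exact: minus_deg tm1.
have [c1 [u1 [w1 [um1 wm1 po1]]]] := IH _ _ _ _ _ x1N sm1 tm1.
have [c2 [u2 [w2 [um2 wm2 po2]]]] := IH _ _ _ _ _ x2N sm2 tm2.
have [b [v1 [v2 [vm1 vm2 po3]]]] := IH _ _ _ _ _ yN wm1 wm2.
exists b, (compm v1 u1), (compm v2 u2).
split; try by apply: minus_wide.2.
rewrite es1 es2; apply: pushout_sym.
(* The two halves, each glued from two squares, share the side [compm w1 t2]. *)
have top := pushout_paste po po1.
have bottom := pushout_paste (pushout_sym po2) po3.
exact: pushout_paste (pushout_sym top) (pushout_sym bottom).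
Qed.

Definition factorization (a b : ob C) := {c : ob C & (hom a c * hom c b)%type}.

Lemma fact_idm (a b c : ob C) (s : hom a c) (u : hom c b) : is_identity s ->
  existT _ c (s, u) = existT _ a (idm a, compm u s) :> factorization a b.
Proof. by move=> H; case: a c s / H u => a u; rewrite compm1. Qed.

Definition fact_pre (a' a b : ob C) (e : hom a a') (x : factorization a' b) :
  factorization a b :=
  existT (fun c : ob C => (hom a c * hom c b)%type) (projT1 x)
    (compm (projT2 x).1 e, (projT2 x).2).

Definition is_factorization (a b : ob C) (f : hom a b) (x : factorization a b) :=
  [/\ rminus (projT2 x).1, rplus (projT2 x).2 &
      f = compm (projT2 x).2 (projT2 x).1].

Lemma factorization_exists (a b : ob C) (f : hom a b) :
  exists x, is_factorization f x.
Proof.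
have [N] := ubnP (rdeg a); elim: N a f => // N IH a f aN.
have [fp|fp] := pselect (rplus f).
  exists (existT _ a (idm a, f)); split=> //=; first exact: minus_wide.1.
  by rewrite compm1.
have [a' [e [d [ed ef]]]] := elementary_factor fp.
have [|x [x1 x2 ex]] := IH a' (compm f d); first exact: leq_trans (elementary_deg ed) _.
exists (fact_pre e x); split=> //=.
  by apply: minus_wide.2 => //; exact: elementary_minus ed.
by rewrite compmA -ex.
Qed.

(** If f factors through an elementary degeneracy e, the injectivity of the
    direct part shows that e can also be split off the inverse part of every
    factorization of f, which leaves a factorization of a map from an object of
    lower degree. *)
Lemma factorization_unique (a b : ob C) (f : hom a b) x y :
  is_factorization f x -> is_factorization f y -> x = y.
Proof.
have [N] := ubnP (rdeg a); elim: N a f x y => // N IH a f x y aN.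
have [fp|fp] := pselect (rplus f).
  have idx z : is_factorization f z -> z = existT _ a (idm a, f).
    case: z => c [s u] [/= sm _ ef]; rewrite ef in fp *.
    exact/fact_idm/(plus_minus (plus_cancel fp) sm).
  by move=> /idx -> /idx ->.
have [a' [e [d [ed ef]]]] := elementary_factor fp.
have a'N : rdeg a' < N by apply: leq_trans (elementary_deg ed) _.
have fact_d z : is_factorization f z ->
    is_factorization (compm f d) (fact_pre d z) /\ z = fact_pre e (fact_pre d z).
  case: z => c [s u] [/= sm up efz].
  have es : compm (compm s d) e = s.
    by apply: (elementary_kernel ed sm up); rewrite !compmA -efz -ef.
  rewrite /fact_pre /= es; split=> //; split=> //=.
    by apply: (minus_cancel ed); rewrite es.
  by rewrite efz compmA.
move=> /fact_d[xd ->] /fact_d[yd ->]; congr fact_pre.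
exact: IH xd yd.
Qed.

Theorem elegant_criterion : is_reedy_except exc /\ elegant D.
Proof.
split; last first.
  move=> r a1 a2 s1 s2 m1 m2; have [b [t1 [t2 [tm1 tm2 po]]]] := minus_pushout m1 m2.
  by exists b, t1, t2; split=> //; exact: pushout_comm po.
split=> // [a b f fm fi|a b f].
  have [a' [e [d [ed _ m]]]] := minus_elem_factor fm fi.
  exact: leq_ltn_trans (minus_deg m) (elementary_deg ed).
have [x xP] := factorization_exists f.
by exists x; split=> // y yP; exact: factorization_unique xP yP.
Qed.
End Criterion.

(** * Inputs of the operations of O_(n,S), and thinness *)

(** Edges in disjoint branches of the tree.  As [New h] is not incomparable to
    any color, a pairwise incomparable sequence is a sequence of such edges or a
    single color. *)
Definition incomparable (c d : color) : bool :=
  match c, d with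
  | Edge p, Edge q => ~~ prefix p q && ~~ prefix q p
  | _, _ => false
  end.

(** A necessary condition for [d] to be an input of an operation with output
    [c]; it says something only if [c] is an edge. *)
Definition above (c d : color) : bool :=
  match c, d with
  | Edge p, Edge q => prefix p q
  | Edge _, New _ => false
  | New _, _ => true
  end.

Lemma incomparable_irr c : incomparable c c = false.
Proof. by case: c => //= p; rewrite prefix_refl. Qed.

Lemma incomparable_sym c d : incomparable c d = incomparable d c.
Proof. by case: c d => [p|g] [q|k] //=; rewrite andbC. Qed.

Lemma above_refl c : above c c.
Proof. by case: c => //= p; rewrite prefix_refl. Qed.

Lemma above_trans d c e : above c d -> above d e -> above c e.
Proof. by case: c d e => [p|g] [q|k] [r|l] //=; apply: prefix_trans. Qed.

Lemma prefix_comparable (p q r : epath) :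
  prefix p r -> prefix q r -> prefix p q || prefix q p.
Proof.
elim: r p q => [|k r IH] [|i p] [|j q] //=.
by move=> /andP[/eqP-> pr] /andP[/eqP-> qr]; rewrite !eqxx /= IH.
Qed.

Lemma incomparable_above c d c' d' :
  incomparable c d -> above c c' -> above d d' -> incomparable c' d'.
Proof.
case: c d c' d' => [p|?] [q|?] [p'|?] [q'|?] //= /andP[npq nqp] pp' qq'.
apply/andP; split; apply/negP => H.
  by have := prefix_comparable (prefix_trans pp' H) qq';
    rewrite (negbTE npq) (negbTE nqp).
by have := prefix_comparable (prefix_trans qq' H) pp';
  rewrite (negbTE npq) (negbTE nqp).
Qed.

Lemma prefix_rcons2 (p : epath) i j : prefix (rcons p i) (rcons p j) = (i == j).
Proof. by elim: p => [|k p IH] /=; rewrite ?eqxx ?andbT. Qed.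

Lemma incomparable_inputs S p : pairwise incomparable (map Edge (inputs S p)).
Proof.
rewrite /inputs; case: subtree_at => // -[//|ts].
rewrite -map_comp pairwise_map.
apply: (@sub_pairwise _ (fun i j => i != j)); last by rewrite -uniq_pairwise iota_uniq.
by move=> i j /= ij; rewrite !prefix_rcons2 ij eq_sym ij.
Qed.

Lemma foldr_and_in (P : term -> Prop) hs :
  foldr (fun h => and (P h)) True hs -> forall h, h \in hs -> P h.
Proof.
elim: hs => //= h hs IH [Ph /IH{}IH] k; rewrite inE => /orP[/eqP->|] //; exact: IH.
Qed.

Lemma gen_wf_level S n h : gen_wf S n (Push h) -> exists2 k, k < n &
  [/\ term_moment h = inl k, wf S k h & wf S n h].
Proof.
move=> /=; case e: (term_moment h) => [k|//] /andP[kn hk].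
exists k => //; split=> //; apply: wf_level hk _.
by rewrite e => j [<-]; exact: ltnW.
Qed.

Lemma src_above S n h : wf S n h -> all (above (term_tgt h)) (term_src h).
Proof.
elim/term_ind_simple: h => [c|g hs IH]; first by rewrite /= above_refl.
rewrite wf_App term_tgt_App => /and3P[_ /eqP e hhs].
case: g e => [p|g] /= e; last by elim: (flatten _).
apply/allP => c /flattenP[s /mapP[h hh ->] hc].
have hu := allP (foldr_and_in IH hh (allP hhs h hh)) _ hc.
have: term_tgt h \in map Edge (inputs S p) by rewrite -e map_f.
case/mapP=> q; rewrite /inputs; case: subtree_at => // -[//|ts].
case/mapP=> i _ -> et; rewrite et in hu.
by apply: above_trans hu; rewrite /= -cats1 prefix_prefix.
Qed.

Lemma incomparable_flatten S n hs cs : map term_tgt hs = cs -> all (wf S n) hs ->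
  pairwise incomparable cs ->
  (forall h, h \in hs -> pairwise incomparable (term_src h)) ->
  pairwise incomparable (flatten (map term_src hs)).
Proof.
move=> <- {cs}; elim: hs => //= h hs IH /andP[hh hhs] /andP[a1 a2] H.
rewrite pairwise_cat IH // ?H ?inE ?eqxx //; last first.
  by move=> k hk; apply: H; rewrite inE hk orbT.
rewrite !andbT; apply/allrelP => c d hc /flattenP[s /mapP[k hk ->] hd].
apply: (@incomparable_above (term_tgt h) (term_tgt k)).
- by apply: (allP a1); rewrite map_f.
- exact: (allP (src_above hh)).
- exact: (allP (src_above (allP hhs _ hk))).
Qed.

(** The inputs of a generator are pairwise incomparable, and grafting replaces
    each of them by colors below it. *)
Lemma src_incomparable S n h : wf S n h -> pairwise incomparable (term_src h).
Proof.
elim/term_ind': h n => [p|g _|p hs IH|g hs IHg IH] n //.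
  rewrite -[wf _ _ _]/(wf S n (App (Vertex p) hs)) wf_App => /and3P[_ /eqP e hhs] /=.
  apply: (incomparable_flatten e hhs (incomparable_inputs _ _)) => h hh.
  exact: (foldr_and_in IH hh n (allP hhs _ hh)).
rewrite wf_App => /and3P[/gen_wf_level[k kn [_ _ hg]] /eqP e hhs] /=.
apply: (incomparable_flatten e hhs (IHg _ hg)) => h hh.
exact: (foldr_and_in IH hh n (allP hhs _ hh)).
Qed.

Lemma src_uniq S n h : wf S n h -> uniq (term_src h).
Proof.
move=> /src_incomparable H; rewrite uniq_pairwise; apply: sub_pairwise H => c d icd.
by apply/eqP => e; rewrite e incomparable_irr in icd.
Qed.

(** The inputs below a vertex are named by longer paths than its output; the
    inputs below an adjoined generator have a smaller moment than its output. *)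
Lemma src_App_neq S n g hs : wf S n (App g hs) ->
  gtgt g \notin term_src (App g hs).
Proof.
rewrite wf_App => /and3P[hg /eqP e hhs]; apply/negP => /flattenP[s /mapP[h hh ->] hc].
have hwf := allP hhs _ hh.
have ht : term_tgt h \in gsrc S g by rewrite -e map_f.
case: g hg {e} hc ht => [p|g] hg /= hc.
  case/mapP=> q; rewrite /inputs; case: subtree_at => // -[//|ts].
  case/mapP=> i _ -> et; have := allP (src_above hwf) _ hc.
  by rewrite et /= => /size_prefix; rewrite size_rcons ltnn.
have [k kn [ek _ gwf]] := gen_wf_level hg.
have [i ei ki] : exists2 i, term_moment h = inl i & k.+1 <= i.
  by apply: (src_moment hwf hc); rewrite /= ek.
move=> ht; have [j ej ij] : exists2 j, term_moment g = inl j & i <= j.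
  by apply: (src_moment gwf ht); rewrite -term_moment_tgt.
move: ej; rewrite ek => -[ekj]; move: (leq_trans ki ij); by rewrite ekj ltnn.
Qed.

Lemma tgt_in_src S n h : wf S n h -> term_tgt h \in term_src h ->
  h = Id (term_tgt h).
Proof.
case: h => // g hs /src_App_neq /negbTE.
by rewrite term_tgt_App => ->.
Qed.

Lemma cat_eq_filter (T : eqType) (P : pred T) (s s' t t' : seq T) :
  all P s -> all P s' -> all (predC P) t -> all (predC P) t' ->
  s ++ t = s' ++ t' -> s = s' /\ t = t'.
Proof.
move=> Ps Ps' Pt Pt' e.
have e1 : s = s'.
  have := congr1 (filter P) e; rewrite !filter_cat.
  rewrite (all_filterP Ps) (all_filterP Ps').
  have f0 r : all (predC P) r -> filter P r = [::].
    by elim: r => //= x r IH /andP[/negbTE-> /IH].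
  by rewrite !f0 // !cats0.
by split=> //; apply/eqP; move/eqP: e; rewrite e1 eqseq_cat // eqxx.
Qed.

(** The output names the outermost generator.  The inputs of the whole that come
    from the i-th argument are those below the i-th input of that generator,
    because distinct inputs of a generator are incomparable; so the list of
    inputs determines the lists of inputs of the arguments. *)
Lemma operad_thin S n h k : wf S n h -> wf S n k ->
  term_src h = term_src k -> term_tgt h = term_tgt k -> h = k.
Proof.
elim/term_ind_simple: h k => [c|g hs IH] k.
  move=> _ kwf /= es et; rewrite et; apply/esym/(tgt_in_src kwf).
  by rewrite -es inE et.
case: k => [c|g' ks] hwf kwf es.
  by move=> et; rewrite (tgt_in_src hwf) ?et // es inE.
rewrite !term_tgt_App => et.
have eg : g = g' by case: (g) (g') et => [p|u] [q|u'] //= [->].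
move: g' eg kwf es {et} => _ <-; rewrite !wf_App => kwf /= es; congr App.
move: hwf; rewrite wf_App => /and3P[gwf /eqP e hhs]; case/and3P: kwf => _ /eqP e' kks.
have: pairwise incomparable (gsrc S g).
  case: (g) gwf => [p _|u /gen_wf_level[j _ [_ _ uwf]]] /=; first exact: incomparable_inputs.
  exact: src_incomparable uwf.
move: (gsrc S g) e e' => cs e e'; elim: cs hs ks e e' hhs kks es IH {gwf}.
  by move=> [|//] [|//].
move=> c cs IH [//|h hs] [//|k ks] /= [eh ehs] [ek eks] /andP[hwf hhs] /andP[kwf kks].
move=> es [Ph Phs] /andP[ic pcs].
have out ls : map term_tgt ls = cs -> all (wf S n) ls ->
    all (predC (above c)) (flatten (map term_src ls)).
  move=> el lwf; apply/allP => d /flattenP[s /mapP[l hl ->] hd] /=.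
  apply/negP => ucd; have := incomparable_above (allP ic (term_tgt l) _) ucd
    (allP (src_above (allP lwf _ hl)) _ hd).
  by rewrite incomparable_irr -el map_f //; move/(_ isT).
have [e1 e2] := cat_eq_filter (P := above c)
  (etrans (congr1 (fun c => all (above c) _) (esym eh)) (src_above hwf))
  (etrans (congr1 (fun c => all (above c) _) (esym ek)) (src_above kwf))
  (out _ ehs hhs) (out _ eks kks) es.
congr cons; first by apply: Ph; rewrite ?eh ?ek.
exact: IH.
Qed.

(** * A map of rooted actions acts on raw colors, terms and moments *)

Section RawMap.
Variables (n m : nat) (S R : option ptree) (X : ra_map (RA n S) (RA m R)).

(** The effect of [X] on raw colors, and below on raw terms and moments.  Outside
    the well-formed ones it is the identity, so that later statements need not
    mention proofs of well-formedness. *)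
Definition col_im (c : color) : color :=
  if (insub c : option (O_col n S)) is Some c' then
    val (cmap (Xd X) c' : O_col m R) else c.
Definition op_im (h : term) : term :=
  if (insub h : option (O_op n S)) is Some h' then
    val (Xd X h' : O_op m R) else h.
Definition mom_im (x : moment) : moment :=
  if (insub x : option {x : moment | moment_wf S n x}) is Some x' then
    val (Xc X x' : {x : moment | moment_wf R m x}) else x.

Lemma col_imE (c : O_col n S) : col_im (val c) = val (cmap (Xd X) c : O_col m R).
Proof. by rewrite /col_im valK. Qed.
Lemma op_imE (h : O_op n S) : op_im (val h) = val (Xd X h : O_op m R).
Proof. by rewrite /op_im valK. Qed.
Lemma mom_imE (x : {x : moment | moment_wf S n x}) :
  mom_im (val x) = val (Xc X x : {x : moment | moment_wf R m x}).
Proof. by rewrite /mom_im valK. Qed.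

Lemma col_im_wf c : color_wf S n c -> color_wf R m (col_im c).
Proof. by move=> H; rewrite -[c]/(val (Sub c H : O_col n S)) col_imE; exact: valP. Qed.
Lemma op_im_wf h : wf S n h -> wf R m (op_im h).
Proof. by move=> H; rewrite -[h]/(val (Sub h H : O_op n S)) op_imE; exact: valP. Qed.
Lemma mom_im_wf x : moment_wf S n x -> moment_wf R m (mom_im x).
Proof.
move=> H; rewrite -[x]/(val (Sub x H : {x : moment | moment_wf S n x})) mom_imE.
exact: valP.
Qed.

Lemma op_im_src h : wf S n h -> term_src (op_im h) = map col_im (term_src h).
Proof.
move=> H; pose h' := Sub h H : O_op n S.
have e : O_src (Xd X h') = map (cmap (Xd X)) (O_src h') := omap_src (Xd X) h'.
rewrite -[h]/(val h') op_imE -!O_srcE e -!map_comp.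
by apply: eq_map => c /=; rewrite col_imE.
Qed.

Lemma op_im_tgt h : wf S n h -> term_tgt (op_im h) = col_im (term_tgt h).
Proof.
move=> H; rewrite -[h]/(val (Sub h H : O_op n S)) op_imE.
have := congr1 val (omap_tgt (Xd X) (Sub h H : O_op n S)) => /= ->.
by rewrite -col_imE.
Qed.

Lemma op_im_Id c : color_wf S n c -> op_im (Id c) = Id (col_im c).
Proof.
move=> H; rewrite -[c]/(val (Sub c H : O_col n S)).
rewrite -[Id _]/(val (O_id (Sub c H : O_col n S))) op_imE col_imE.
by have := congr1 val (omap_id (Xd X) (Sub c H : O_col n S)) => /= ->.
Qed.

Lemma op_im_moment h : wf S n h -> term_moment (op_im h) = mom_im (term_moment h).
Proof.
move=> H; rewrite -[h]/(val (Sub h H : O_op n S)) op_imE.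
have := congr1 val (ra_mu X (Sub h H : O_op n S)) => /= ->.
by rewrite -mom_imE.
Qed.

Lemma col_im_moment c : color_wf S n c -> color_moment (col_im c) = mom_im (color_moment c).
Proof.
move=> H; have := @op_im_moment (Id c); rewrite wf_Id op_im_Id // !term_moment_tgt.
exact.
Qed.

Lemma mom_im_le x y : moment_wf S n x -> moment_wf S n y -> moment_le x y ->
  moment_le (mom_im x) (mom_im y).
Proof.
move=> Hx Hy xy.
pose x' := Sub x Hx : {x : moment | moment_wf S n x}.
pose y' := Sub y Hy : {x : moment | moment_wf S n x}.
rewrite -[x]/(val x') -[y]/(val y') (mom_imE x') (mom_imE y').
exact: (@fmap _ _ (Xc X) x' y' xy).
Qed.

Lemma op_im_raw_act x y h : wf S n h -> term_moment h = x -> moment_wf S n y ->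
  moment_le x y ->
  op_im (raw_act x y h) = raw_act (mom_im x) (mom_im y) (op_im h).
Proof.
move=> H ex Hy xy.
have Hx : moment_wf S n x by rewrite -ex; exact: term_moment_wf.
pose x' := Sub x Hx : {x : moment | moment_wf S n x}.
pose y' := Sub y Hy : {x : moment | moment_wf S n x}.
pose h' := Sub h H : O_op n S.
have eh : mu (RA n S) h' = x' by exact: val_inj.
have K : mu (RA m R) (Xd X h') = Xc X x' by rewrite ra_mu eh.
have E := congr1 val (@ra_act _ _ X x' y' xy h' eh K).
pose a := act (RA n S) (xy : @hom (acat (RA n S)) x' y') eh : O_op n S.
rewrite -[raw_act x y h]/(val a) -[x in RHS]/(val x') -[y in RHS]/(val y').
rewrite -[h in RHS]/(val h') (mom_imE x') (mom_imE y') !op_imE; exact: E.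
Qed.

Lemma op_im_push h k : wf S n h -> term_moment h = inl k -> k < n ->
  op_im (push h) = raw_act (mom_im (inl k)) (mom_im (inl k.+1)) (op_im h).
Proof.
move=> H ek kn; rewrite -op_im_raw_act //=.
by rewrite subSn // subnn.
Qed.

Lemma col_im_New h k : wf S n h -> term_moment h = inl k -> k < n ->
  col_im (New h) = term_tgt (raw_act (mom_im (inl k)) (mom_im (inl k.+1)) (op_im h)).
Proof.
move=> H ek kn; rewrite -op_im_push // op_im_tgt ?term_tgt_App //.
exact: push_wf H ek kn.
Qed.

End RawMap.

Section Compare.
Variables (n m : nat) (S R : option ptree).
Implicit Types X Y : ra_map (RA n S) (RA m R).

Lemma functor_ext (C D : category) (F G : functor C D) :
  (forall a b (f g : @hom D a b), f = g) -> (forall a, F a = G a) -> F = G.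
Proof.
case: F G => [fo fm f1 f2] [go gm g1 g2] irr /= /funext e.
case: go / e gm g1 g2 => gm g1 g2.
have e : fm = gm by apply/functional_extensionality_dep => a;
  apply/functional_extensionality_dep => b; apply/functional_extensionality_dep => f.
case: gm / e g1 g2 => g1 g2; exact: functor_eqP.
Qed.

Lemma operad_map_ext (O P : operad) (F G : operad_map O P) :
  (forall c, cmap F c = cmap G c) -> (forall h, F h = G h) -> F = G.
Proof.
case: F G => [fo fm p1 p2 p3 p4] [go gm q1 q2 q3 q4] /= /funext e /funext e'.
case: go / e q1 q2 q3 q4; case: gm / e' => *; exact: operad_map_eqP.
Qed.

Lemma op_im_ext X Y h : wf S n h ->
  (forall c, color_wf S n c -> c = term_tgt h \/ c \in term_src h ->
     col_im X c = col_im Y c) ->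
  op_im X h = op_im Y h.
Proof.
move=> H E; apply: (@operad_thin R m); rewrite ?op_im_wf ?op_im_src ?op_im_tgt //.
  apply/eq_in_map => c hc; apply: E; last by right.
  exact: (allP (src_term_wf H)).
by apply: E; [exact: tgt_term_wf | left].
Qed.

Lemma wf_src_level h k c : wf S k h -> c \in term_src h -> color_wf S k c.
Proof. by move=> /src_term_wf/allP; apply. Qed.

(** By thinness, maps that agree on colors agree on operations.  A color [New h]
    of level k + 1 is the output of the action of the step from k to k + 1 on
    [h], whose colors have level at most k; this gives an induction on the
    level. *)
Lemma col_im_ext X Y :
  (forall i, i <= n -> mom_im X (inl i) = mom_im Y (inl i)) ->
  (forall p, is_edge S p -> col_im X (Edge p) = col_im Y (Edge p)) ->
  forall c, color_wf S n c -> col_im X c = col_im Y c.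
Proof.
move=> Em Ec.
suff H k c : color_wf S k c -> color_wf S n c -> col_im X c = col_im Y c.
  by move=> c hc; exact: (H _ _ hc hc).
elim: k c => [|k IH] [p|h] //=; [by move=> *; exact: Ec | | by move=> *; exact: Ec | ].
  by case: (term_moment h).
case eh: (term_moment h) => [j|//] /andP[jk hj] /andP[jn _].
have hn : wf S n h by apply: wf_level hj _; rewrite eh => i [<-]; exact: ltnW.
have hk : wf S k h by apply: wf_level hj _; rewrite eh => i [<-].
rewrite !(col_im_New _ hn eh jn) (Em _ jn) (Em _ (ltnW jn)).
congr (term_tgt (raw_act _ _ _)); apply: op_im_ext => // c hc [ec|hs]; apply: IH => //.
  by rewrite ec; exact: tgt_term_wf.
exact: wf_src_level hk hs.
Qed.

(** The isolated objects of the acting category are moments of edges, so the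
    images of edges also determine the functor there. *)
Lemma ra_map_ext X Y :
  (forall i, i <= n -> mom_im X (inl i) = mom_im Y (inl i)) ->
  (forall p, is_edge S p -> col_im X (Edge p) = col_im Y (Edge p)) ->
  X = Y.
Proof.
move=> Em Ec; have E := col_im_ext Em Ec.
apply: ra_map_eqP.
  apply: functor_ext => [a b f g|[x hx]]; first exact: bool_irrelevance.
  apply: val_inj; rewrite -!(mom_imE _ (exist _ x hx)) /=.
  case: x hx => [i|p] hx; first by rewrite Em.
  have [hp p0] := andP hx.
  have ep : color_moment (Edge p) = inr p by case: (p) p0.
  by rewrite -ep -!col_im_moment // Ec.
apply: operad_map_ext => [c|h]; apply: val_inj.
  by rewrite -!col_imE; apply: E; exact: valP.
by rewrite -!op_imE; apply: op_im_ext => [|c hc _]; [exact: valP | exact: E].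
Qed.

End Compare.

Lemma col_im_comp n m l S R Q (X : ra_map (RA n S) (RA m R))
    (Y : ra_map (RA m R) (RA l Q)) c : color_wf S n c ->
  col_im (ra_comp Y X) c = col_im Y (col_im X c).
Proof.
move=> H; rewrite -[c]/(val (Sub c H : O_col n S)) (col_imE X) (col_imE (ra_comp Y X)).
by rewrite [in RHS]col_imE.
Qed.

Lemma mom_im_comp n m l S R Q (X : ra_map (RA n S) (RA m R))
    (Y : ra_map (RA m R) (RA l Q)) x : moment_wf S n x ->
  mom_im (ra_comp Y X) x = mom_im Y (mom_im X x).
Proof.
move=> H; rewrite -[x]/(val (Sub x H : {x : moment | moment_wf S n x})).
by rewrite (mom_imE X) (mom_imE (ra_comp Y X)) [in RHS]mom_imE.
Qed.

Lemma col_im_id n S c : col_im (ra_id (RA n S)) c = c.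
Proof. by rewrite /col_im; case: insubP => //= u _ <-. Qed.
Lemma mom_im_id n S x : mom_im (ra_id (RA n S)) x = x.
Proof. by rewrite /mom_im; case: insubP => //= u _ <-. Qed.

(** * Maps that send edges to edges *)

Lemma graft_graft h hs gs : map term_tgt hs = term_src h ->
  map term_tgt gs = flatten (map term_src hs) ->
  graft (graft h hs) gs = graft h (grafts hs gs).
Proof.
move=> H K; have [ys [ey1 ey2 ey3 ey4]] : exists ys : seq (term * seq term),
    [/\ map fst ys = hs, flatten (map snd ys) = gs,
        [seq graft y.1 y.2 | y <- ys] = grafts hs gs &
        forall y, y \in ys -> map term_tgt y.2 = term_src y.1].
  elim: hs gs {H} K => [|h' hs IH] gs; first by exists [::]; case: gs K.
  move=> /= /split_tgt[e1 /IH[ys [<- e2 e3 H]]].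
  exists ((h', take (size (term_src h')) gs) :: ys); split=> //=.
  - by rewrite e2 cat_take_drop.
  - by rewrite e3.
  - by move=> y; rewrite inE => /orP[/eqP->|/H].
by rewrite -ey1 -{1}ey2 graft_assoc ?ey1 // ey3.
Qed.

Section Build.
Variables (n m : nat) (S R : option ptree).
Variables (a : nat -> nat) (f : epath -> epath) (v : epath -> term).
Hypothesis a0 : a 0 = 0.
Hypothesis a_mono : forall i j, i <= j -> j <= n -> a i <= a j.
Hypothesis a_bound : forall i, i <= n -> a i <= m.
Hypothesis f0 : f [::] = [::].
Hypothesis f_edge : forall p, is_edge S p -> is_edge R (f p).
Hypothesis vP : forall p, is_vertex S p ->
  [/\ wf R m (v p), term_src (v p) = map Edge (map f (inputs S p))
    & term_tgt (v p) = Edge (f p)].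

Definition ext_mom (x : moment) : moment :=
  match x with inl i => inl (a i) | inr p => edge_moment (f p) end.

Definition ext_raise (x : moment) (h : term) : term :=
  if x is inl k then iter (a k.+1 - a k) push h else h.

(** The extension to the freely generated operad: a vertex goes to the operation
    chosen for it, and an adjoined generator to the action of the step from
    [a k] to [a k.+1] on the image of the operation it was adjoined for. *)
Fixpoint ext_term (h : term) : term :=
  match h with
  | Id (Edge p) => Id (Edge (f p))
  | Id (New g) => Id (term_tgt (ext_raise (term_moment g) (ext_term g)))
  | App (Vertex p) hs => graft (v p) (map ext_term hs)
  | App (Push g) hs => graft (ext_raise (term_moment g) (ext_term g)) (map ext_term hs)
  end.

Definition ext_col (c : color) : color :=
  match c with
  | Edge p => Edge (f p)
  | New g => term_tgt (ext_raise (term_moment g) (ext_term g))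
  end.

Definition ext_gen (g : gen) : term :=
  match g with Vertex p => v p | Push g => ext_raise (term_moment g) (ext_term g) end.

Lemma ext_term_Id c : ext_term (Id c) = Id (ext_col c).
Proof. by case: c. Qed.

Lemma ext_term_App g hs : ext_term (App g hs) = graft (ext_gen g) (map ext_term hs).
Proof. by case: g. Qed.

Lemma ext_mom_wf x : moment_wf S n x -> moment_wf R m (ext_mom x).
Proof.
case: x => [i|p] /=; first exact: a_bound.
by move=> /andP[/f_edge/edge_moment_wf].
Qed.

Lemma ext_mom_le x y : moment_wf S n y -> moment_le x y ->
  moment_le (ext_mom x) (ext_mom y).
Proof.
case: x y => [i|p] [j|q] //= H; first by move=> ij; exact: a_mono.
by move=> /eqP->; exact: moment_le_refl.
Qed.

Lemma ext_mom_edge p : edge_moment (f p) = ext_mom (edge_moment p).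
Proof. by case: p => //=; rewrite f0 a0. Qed.

Definition ext_ok h :=
  [/\ wf R m (ext_term h), term_tgt (ext_term h) = ext_col (term_tgt h),
  term_src (ext_term h) = map ext_col (term_src h)
  & term_moment (ext_term h) = ext_mom (term_moment h)].

Lemma ext_raise_good h k : wf S n h -> term_moment h = inl k -> k < n -> ext_ok h ->
  [/\ wf R m (ext_raise (term_moment h) (ext_term h)),
      term_src (ext_raise (term_moment h) (ext_term h)) = map ext_col (term_src h)
    & term_moment (ext_raise (term_moment h) (ext_term h)) = inl (a k.+1)].
Proof.
move=> hwf ek kn [bwf _ bs bm]; rewrite ek /= iter_push_src bs.
have ak : a k <= a k.+1 by exact: a_mono.
have [] := @iter_push R m (ext_term h) (a k) (a k.+1 - a k) bwf.
- by rewrite bm ek.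
- by rewrite subnKC // a_bound.
- by rewrite subnKC.
Qed.

Lemma ext_ok_graft h hs : wf R m h -> (forall k, k \in hs -> ext_ok k) ->
  term_src h = map ext_col (map term_tgt hs) ->
  [/\ wf R m (graft h (map ext_term hs)),
      term_tgt (graft h (map ext_term hs)) = term_tgt h &
      term_src (graft h (map ext_term hs)) = map ext_col (flatten (map term_src hs))].
Proof.
move=> hwf H es.
have et : map term_tgt (map ext_term hs) = term_src h.
  rewrite es -!map_comp; by apply/eq_in_map => k /H[_ /= -> _ _].
split.
- apply: graft_wf => //; rewrite all_map; apply/allP => k /H[] //.
- exact: graft_tgt.
- rewrite graft_src // map_flatten -!map_comp; congr flatten.
  by apply/eq_in_map => k /H[].
Qed.

Lemma ext_ok_Id c : color_wf R m (ext_col c) ->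
  color_moment (ext_col c) = ext_mom (color_moment c) -> ext_ok (Id c).
Proof. by move=> H e; rewrite /ext_ok ext_term_Id wf_Id !term_moment_tgt. Qed.

Lemma ext_termP h : wf S n h -> ext_ok h.
Proof.
elim/term_ind': h => [p|g IH|p hs IH|g hs IHg IH] H.
- by apply: ext_ok_Id; [exact: f_edge | exact: ext_mom_edge].
- have [k kn [ek _ gwf]] := gen_wf_level (H : gen_wf S n (Push g)).
  have [w s e] := ext_raise_good gwf ek kn (IH gwf).
  by apply: ext_ok_Id => /=; rewrite ?tgt_term_wf // -term_moment_tgt e ek.
- move: H; rewrite wf_App => /and3P[pv /eqP e hhs].
  have [w s t] := vP pv.
  have [||w' t' s'] := ext_ok_graft (hs := hs) w.
  + by move=> k hk; exact: (foldr_and_in IH hk (allP hhs _ hk)).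
  + by rewrite s e /= -!map_comp.
  split=> //; rewrite ?[ext_term _]/= ?t' ?t //.
  by rewrite term_moment_tgt t' t /=; exact: ext_mom_edge.
- move: H; rewrite wf_App => /and3P[pv /eqP e hhs].
  have [k kn [ek _ gwf]] := gen_wf_level pv.
  have [w s em] := ext_raise_good gwf ek kn (IHg gwf).
  have [||w' t' s'] := ext_ok_graft (hs := hs) w.
  + by move=> l hl; exact: (foldr_and_in IH hl (allP hhs _ hl)).
  + by rewrite s e.
  split=> //; rewrite ?[ext_term _]/= ?t' //.
  by rewrite term_moment_tgt t' -term_moment_tgt em /= ek.
Qed.

Lemma ext_col_wf c : color_wf S n c -> color_wf R m (ext_col c).
Proof. by move=> H; case: (@ext_termP (Id c)); rewrite ?wf_Id // ext_term_Id wf_Id. Qed.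

Lemma ext_term_graft h gs : wf S n h -> all (wf S n) gs ->
  map term_tgt gs = term_src h ->
  ext_term (graft h gs) = graft (ext_term h) (map ext_term gs).
Proof.
elim/term_ind_simple: h gs => [c|g hs IH] gs H Hg.
  by rewrite ext_term_Id; case: gs Hg => [|k [|]].
rewrite [term_src _]/= => eg; rewrite graft_App !ext_term_App.
move: (H); rewrite wf_App => /and3P[pv /eqP e hhs].
have eb ks : all (wf S n) ks -> map term_tgt (map ext_term ks) = map ext_col (map term_tgt ks).
  by move=> kks; rewrite -!map_comp; apply/eq_in_map => k /(allP kks) /ext_termP[].
have eb' ks : all (wf S n) ks ->
    flatten (map term_src (map ext_term ks)) = map ext_col (flatten (map term_src ks)).
  move=> kks; rewrite map_flatten -!map_comp; congr flatten.
  by apply/eq_in_map => k /(allP kks) /ext_termP[].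
rewrite graft_graft.
- congr graft; elim: hs IH gs Hg eg hhs {H e} => //= h hs IH [Ph /IH{}IH] gs Hg.
  move=> /split_tgt[e1 e2] /andP[hwf hhs].
  move: Hg; rewrite -{1}(cat_take_drop (size (term_src h)) gs) all_cat => /andP[g1 g2].
  rewrite Ph // IH // map_take map_drop.
  by have [_ _ -> _] := ext_termP hwf; rewrite size_map.
- rewrite eb // e; case: (g) pv => [p|u] pv /=.
    by have [_ -> _] := vP pv; rewrite -!map_comp.
  have [k kn [ek _ gwf]] := gen_wf_level pv.
  by have [_ -> _] := ext_raise_good gwf ek kn (ext_termP gwf).
- by rewrite eb // eb' // eg.
Qed.

Lemma ext_term_push h k : wf S n h -> term_moment h = inl k -> k < n ->
  ext_term (push h) = iter (a k.+1 - a k) push (ext_term h).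
Proof.
move=> H ek kn; rewrite /push ext_term_App -map_comp.
have [_ es _] := ext_raise_good H ek kn (ext_termP H).
rewrite (eq_map (g := Id \o ext_col)); last by move=> c; exact: ext_term_Id.
by rewrite map_comp /ext_gen -es graft1 ek.
Qed.

Lemma ext_term_act x y h : wf S n h -> term_moment h = x -> moment_wf S n y ->
  moment_le x y ->
  ext_term (raw_act x y h) = raw_act (ext_mom x) (ext_mom y) (ext_term h).
Proof.
case: x y => [i|p] [j|q] //= H ex Hy xy; last first.
  by rewrite (eqP xy); case: edge_moment => //= k; rewrite subnn.
move: Hy; rewrite -{1 3}(subnKC xy); elim: (j - i) => [|d IH] le.
  by rewrite addn0 subnn.
have ld : i + d <= n by rewrite (leq_trans _ le) // leq_add2l.
have [w e] := iter_push H ex ld.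
rewrite iterS (ext_term_push w e) ?IH -?addnS // -iterD addnBA ?subnK //.
  by apply: a_mono => //; rewrite leq_add2l.
by apply: a_mono => //; rewrite leq_addr.
Qed.

Definition ext_functor : functor (Ccat n S) (Ccat m R).
Proof.
apply: (@Functor (Ccat n S) (Ccat m R)
  (fun x => Sub (ext_mom (val x)) (ext_mom_wf (valP x)) : ob (Ccat m R))
  (fun x y xy => ext_mom_le (valP y) xy)).
- by move=> x; exact: bool_irrelevance.
- by move=> x y z g h; exact: bool_irrelevance.
Defined.

Lemma ext_term_wf h : wf S n h -> wf R m (ext_term h).
Proof. by case/ext_termP. Qed.

Definition ext_operad_map : operad_map (Oper n S) (Oper m R).
Proof.
apply: (@OperadMap (Oper n S) (Oper m R)
  (fun c : O_col n S => Sub (ext_col (val c)) (ext_col_wf (valP c)) : O_col m R)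
  (fun h : O_op n S => Sub (ext_term (val h)) (ext_term_wf (valP h)) : O_op m R)).
- move=> h; apply: (inj_map val_inj); rewrite O_srcE /=.
  have [_ _ -> _] := ext_termP (valP h).
  by rewrite -[in LHS]O_srcE -!map_comp.
- by move=> h; apply: val_inj => /=; have [] := ext_termP (valP h).
- by move=> c; apply: val_inj; exact: ext_term_Id.
- move=> g gs H K; apply: val_inj => /=.
  rewrite ext_term_graft ?valP ?O_wf_all ?(O_composable H) //.
  by rewrite -!map_comp.
Defined.

Definition ext_map : ra_map (RA n S) (RA m R).
Proof.
apply: (@RAMap (RA n S) (RA m R) ext_functor ext_operad_map).
- by move=> g; apply: val_inj => /=; have [] := ext_termP (valP g).
- move=> x y xy g H K; apply: val_inj => /=.
  apply: ext_term_act => //; [exact: valP | by rewrite -H | exact: valP].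
Defined.

End Build.

(** The elementary degeneracies and their sections are of this form, which turns
    equations between their composites into equations between functions. *)
Definition edgewise n m S R (X : ra_map (RA n S) (RA m R)) (a : nat -> nat)
    (f : epath -> epath) :=
  (forall i, i <= n -> mom_im X (inl i) = inl (a i)) /\
  (forall p, is_edge S p -> col_im X (Edge p) = Edge (f p)).

Lemma edgewise_exists n m S R (a : nat -> nat) (f : epath -> epath) :
  a 0 = 0 -> (forall i j, i <= j -> j <= n -> a i <= a j) ->
  (forall i, i <= n -> a i <= m) ->
  f [::] = [::] -> (forall p, is_edge S p -> is_edge R (f p)) ->
  (forall p, is_vertex S p -> exists h,
     [/\ wf R m h, term_src h = map Edge (map f (inputs S p))
       & term_tgt h = Edge (f p)]) ->
  exists X : ra_map (RA n S) (RA m R), edgewise X a f.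
Proof.
move=> a0 am ab f0 fe H.
have /boolp.choice[v vP] p : exists h, is_vertex S p ->
     [/\ wf R m h, term_src h = map Edge (map f (inputs S p))
       & term_tgt h = Edge (f p)].
  case: (boolP (is_vertex S p)) => [/H[h ?]|_]; first by exists h.
  by exists (Id (Edge [::])).
exists (ext_map a0 am ab f0 fe vP); split=> [i hi|p hp].
  by rewrite -[inl i]/(val (Sub (inl i : moment) hi : {x : moment | moment_wf S n x})) mom_imE.
by rewrite -[Edge p]/(val (Sub (Edge p : color) hp : O_col n S)) col_imE.
Qed.

(** * The order of the colors, and injectivity of direct maps *)

Lemma subtree_cat t p q :
  subtree t (p ++ q) = if subtree t p is Some u then subtree u q else None.
Proof.
by elim: p t => [|i p IH] [|ts] //=; case: (onth ts i) => //.
Qed.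

Lemma subtree_at_cat S p q :
  subtree_at S (p ++ q) = if subtree_at S p is Some u then subtree u q else None.
Proof. by case: S => //= t; exact: subtree_cat. Qed.

Lemma is_edge_cat S p q : is_edge S (p ++ q) -> is_edge S p.
Proof. by rewrite /is_edge subtree_at_cat; case: subtree_at. Qed.

Lemma is_edge_rcons S p i : is_edge S (rcons p i) ->
  is_vertex S p /\ rcons p i \in inputs S p.
Proof.
rewrite /is_edge -cats1 subtree_at_cat /is_vertex /inputs.
case: subtree_at => // -[|ts] //=; case e: (onth ts i) => [u|] // _; split=> //.
by rewrite cats1 map_f // mem_iota /= -onthTE e.
Qed.

Lemma inputs_edge S p q : q \in inputs S p -> is_edge S q.
Proof.
rewrite /inputs /is_edge; case e: subtree_at => [[|ts]|] // /mapP[i].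
rewrite mem_iota /= add0n -onthTE => hi ->.
by rewrite -cats1 subtree_at_cat e /=; case: (onth ts i) hi => // -[].
Qed.

Lemma inputsP S p q : q \in inputs S p -> exists i, q = rcons p i.
Proof.
rewrite /inputs; case: subtree_at => [[|ts]|] // /mapP[i _ ->]; by exists i.
Qed.

Definition corolla S p := App (Vertex p) (map Id (map Edge (inputs S p))).

Lemma corolla_wf S n p : is_vertex S p -> wf S n (corolla S p).
Proof.
move=> H; rewrite wf_App /= H -!map_comp eqxx all_map.
by apply/allP => q; exact: inputs_edge.
Qed.

Lemma corolla_src S p : term_src (corolla S p) = map Edge (inputs S p).
Proof. by rewrite /= -map_comp /comp /= flatten_map1 map_id. Qed.

Definition input_of n S (c d : color) :=
  exists2 h, wf S n h & c \in term_src h /\ term_tgt h = d.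

Section Order.
Variables (n : nat) (S : option ptree).
Notation input_of := (input_of n S).

Lemma input_of_refl c : color_wf S n c -> input_of c c.
Proof. by move=> H; exists (Id c); rewrite ?wf_Id // inE. Qed.

Lemma graft_src_through h k c : wf S n h -> wf S n k ->
  c \in term_src h -> term_tgt h \in term_src k ->
  exists2 gs, wf S n (graft k gs) & c \in term_src (graft k gs) /\
     term_tgt (graft k gs) = term_tgt k.
Proof.
move=> hwf kwf hc hk.
pose gs := [seq if d == term_tgt h then h else Id d | d <- term_src k].
have eg : map term_tgt gs = term_src k.
  by rewrite -map_comp map_id_in // => d _ /=; case: eqP.
exists gs; last split; last exact: graft_tgt.
  apply: graft_wf => //; rewrite all_map; apply/allP => d hd /=.
  by case: eqP => // _; rewrite wf_Id; exact: (allP (src_term_wf kwf)).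
rewrite graft_src //; apply/flattenP; exists (term_src h) => //.
by apply/mapP; exists h => //; apply/mapP; exists (term_tgt h); rewrite // eqxx.
Qed.

Lemma input_of_trans d c e : input_of c d -> input_of d e -> input_of c e.
Proof.
move=> [h hwf [hc <-]] [k kwf [hk <-]].
have [gs g1 [g2 g3]] := graft_src_through hwf kwf hc hk.
by exists (graft k gs).
Qed.

(** The two operations compose to one whose output is among its inputs.  This
    composite is an identity, and then so is its outer factor. *)
Lemma input_of_anti c d : input_of c d -> input_of d c -> c = d.
Proof.
move=> [h hwf [hc <-]] [k kwf [hk et]].
have [gs g1 [g2 g3]] := graft_src_through hwf kwf hc hk.
have := tgt_in_src g1; rewrite g3 et => /(_ g2).
by case: k kwf hk et {g1 g2 g3} => //= e _; rewrite inE => /eqP->.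
Qed.

Lemma input_of_above c d : input_of c d -> above d c.
Proof. by move=> [h hwf [hc <-]]; exact: (allP (src_above hwf)). Qed.

Lemma input_of_moment c d j : input_of c d -> color_moment c = inl j ->
  exists2 i, color_moment d = inl i & j <= i.
Proof.
by move=> [h hwf [hc <-]] ej; rewrite -term_moment_tgt; exact: src_moment hwf hc _ ej.
Qed.

Lemma input_of_edge p q : is_edge S (p ++ q) -> input_of (Edge (p ++ q)) (Edge p).
Proof.
elim/last_ind: q => [|q i IH] H; first by rewrite cats0 in H *; exact: input_of_refl.
move: H; rewrite -rcons_cat => H; have [v hi] := is_edge_rcons H.
apply: (@input_of_trans (Edge (p ++ q))).
  exists (corolla S (p ++ q)); first exact: corolla_wf.
  by rewrite corolla_src map_f.
by apply: IH; exact: vertex_edge.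
Qed.

End Order.

Lemma input_of_col_im n m S R (X : ra_map (RA n S) (RA m R)) c d :
  input_of n S c d -> input_of m R (col_im X c) (col_im X d).
Proof.
move=> [h hwf [hc <-]]; exists (op_im X h); first exact: op_im_wf.
by rewrite op_im_src // map_f // op_im_tgt.
Qed.

Lemma root_edge S p : is_edge S p -> is_edge S [::].
Proof. exact: (@is_edge_cat S [::] p). Qed.

Lemma col_im_root_moment n m S R (X : ra_map (RA n S) (RA m R)) :
  is_edge S [::] -> color_moment (col_im X (Edge [::])) = mom_im X (inl 0).
Proof. by move=> H; rewrite col_im_moment. Qed.

Lemma mom_im_cases n m S R (X : ra_map (RA n S) (RA m R)) :
  (exists q, forall i, i <= n -> mom_im X (inl i) = inr q) \/
  (exists a, [/\ forall i, i <= n -> mom_im X (inl i) = inl (a i),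
      forall i, i <= n -> a i <= m &
      forall i j, i <= j -> j <= n -> a i <= a j]).
Proof.
have le i j : i <= j -> j <= n -> moment_le (mom_im X (inl i)) (mom_im X (inl j)).
  by move=> ij jn; apply: mom_im_le => //=; exact: leq_trans jn.
case e0: (mom_im X (inl 0)) => [k|q]; last first.
  left; exists q => i hi; have := le 0 i isT hi.
  by rewrite e0; case: mom_im => //= r /eqP->.
right; pose a i := if mom_im X (inl i) is inl j then j else 0.
have Ea i : i <= n -> mom_im X (inl i) = inl (a i).
  by move=> hi; have := le 0 i isT hi; rewrite /a e0; case: mom_im.
exists a; split=> // [i hi|i j ij jn].
  by have := @mom_im_wf _ _ _ _ X (inl i) hi; rewrite Ea.
by have := le i j ij jn; rewrite !Ea // (leq_trans ij).
Qed.

Lemma tgt_iter_push h d : term_tgt (iter d.+1 push h) = New (iter d push h).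
Proof. by []. Qed.

Lemma iter_push_inj d : injective (iter d push).
Proof. by elim: d => [|d IH] h k //= [/IH]. Qed.

Section Plus.
Variables (n m : nat) (S R : option ptree) (X : ra_map (RA n S) (RA m R)).

Definition plus_map :=
  (forall i j, i <= n -> j <= n -> mom_im X (inl i) = mom_im X (inl j) -> i = j) /\
  (forall p q, is_edge S p -> is_edge S q ->
     col_im X (Edge p) = col_im X (Edge q) -> p = q).

Hypothesis XP : plus_map.

Lemma plus_mom_im : 0 < n -> exists a,
  [/\ forall i, i <= n -> mom_im X (inl i) = inl (a i),
      forall i, i <= n -> a i <= m &
      forall i j, i < j -> j <= n -> a i < a j].
Proof.
move=> n0; case: (mom_im_cases X) => [[q Eq]|[a [Ea ab am]]].
  by have := XP.1 0 n isT (leqnn n); rewrite !Eq // => /(_ erefl) e; rewrite -e in n0.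
exists a; split=> // i j ij jn; rewrite ltn_neqAle am // ?andbT; last exact: ltnW.
apply/eqP => e; have hi : i <= n by exact: leq_trans (ltnW ij) jn.
have := XP.1 i j hi jn; rewrite !Ea // e => /(_ erefl) eij.
by rewrite eij ltnn in ij.
Qed.

Lemma New_lt h : color_wf S n (New h) -> exists2 k, term_moment h = inl k &
  [/\ k < n, wf S k h & wf S n h].
Proof. by move=> H; have [k ? [? ? ?]] := @gen_wf_level S n h H; exists k. Qed.

(** The number of additional pushes depends only on the level, which is what
    makes the comparison of two such images possible. *)
Lemma col_im_New_plus : exists d : nat -> nat, forall h k,
  term_moment h = inl k -> color_wf S n (New h) ->
  col_im X (New h) = New (iter (d k) push (op_im X h)).
Proof.
have [n0|n0] := leqP n 0.
  exists (fun=> 0) => h k ek /New_lt[j _ [jn _ _]].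
  by have := leq_trans jn n0.
have [a [Ea ab am]] := plus_mom_im n0.
exists (fun k => (a k.+1 - a k).-1) => h k ek /New_lt[k' ek' [kn _ hwf]].
move: ek'; rewrite ek => -[e]; rewrite -{k'}e in kn.
rewrite (col_im_New X hwf ek kn) !Ea ?(ltnW kn) //= -(tgt_iter_push (op_im X h)).
by rewrite prednK // subn_gt0 am.
Qed.

Lemma edge_moment_le p j : is_edge S p -> color_moment (col_im X (Edge p)) = inl j ->
  exists2 i, mom_im X (inl 0) = inl i & j <= i.
Proof.
move=> hp ej; have rp := input_of_col_im X (@input_of_edge n S [::] p hp).
have [i ei ji] := input_of_moment rp ej.
by exists i; rewrite // -ei col_im_root_moment // (root_edge hp).
Qed.

Lemma New_moment_gt h : color_wf S n (New h) ->
  exists2 j, color_moment (col_im X (New h)) = inl j &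
   forall i, mom_im X (inl 0) = inl i -> i < j.
Proof.
move=> H; have [k ek [kn _ hwf]] := New_lt H.
have [a [Ea ab am]] := plus_mom_im (leq_ltn_trans (leq0n k) kn).
exists (a k.+1); first by rewrite col_im_moment //= ek /= Ea.
by move=> i; rewrite Ea // => -[<-]; exact: am.
Qed.

Lemma edge_New_neq p h : is_edge S p -> color_wf S n (New h) ->
  col_im X (Edge p) <> col_im X (New h).
Proof.
move=> hp hh e; have [j ej lt] := New_moment_gt hh.
rewrite -e in ej; have [i ei] := edge_moment_le hp ej.
by rewrite leqNgt (lt i ei).
Qed.

(** Edges have at most the moment of the root and new colors a larger one, so
    their images differ.  New colors with the same image have the same level,
    and come from operations with the same image; these have the same inputs and
    output by induction on the level, and are equal by thinness. *)
Lemma plus_col_im c d : color_wf S n c -> color_wf S n d ->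
  col_im X c = col_im X d -> c = d.
Proof.
suff H k c' d' : color_wf S k c' -> color_wf S k d' -> color_wf S n c' ->
    color_wf S n d' -> col_im X c' = col_im X d' -> c' = d'.
  by move=> hc hd; exact: (H n).
elim: k c' d' => [|k IH] [p|h] [q|h'].
- by move=> _ _ hp hq /XP.2 ->.
- by move=> _ _ hp hq /edge_New_neq; case.
- by move=> _ _ hp hq /esym/edge_New_neq; case.
- by move=> /= hh; exfalso; case: term_moment hh.
- by move=> _ _ hp hq /XP.2 ->.
- by move=> _ _ hp hq /edge_New_neq; case.
- by move=> _ _ hp hq /esym/edge_New_neq; case.
move=> hk hk' hn hn' e.
have low g : color_wf S k.+1 (New g) -> wf S k g.
  move=> /= ; case eg: (term_moment g) => [l|//] /andP[lk gl].
  by apply: wf_level gl _; rewrite eg => _ [<-].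
have hwk := low _ hk; have hwk' := low _ hk'.
have [i ei [iin _ hwf]] := New_lt hn; have [i' ei' [iin' _ hwf']] := New_lt hn'.
have ii' : i = i'.
  have := congr1 color_moment e; rewrite !col_im_moment //= ei ei' /=.
  by move=> /XP.1 -/(_ iin iin') [].
have [r Er] := col_im_New_plus; move: e.
rewrite (Er _ _ ei hn) (Er _ _ ei' hn') -ii' => -[/iter_push_inj eo].
pose P x := color_wf S k x && color_wf S n x.
have IHP x y : P x -> P y -> col_im X x = col_im X y -> x = y.
  by move=> /andP[? ?] /andP[? ?]; exact: IH.
have srcP g : wf S k g -> wf S n g -> all P (term_src g).
  by move=> gk gn; rewrite all_predI !src_term_wf.
have tgtP g : wf S k g -> wf S n g -> P (term_tgt g).
  by move=> gk gn; rewrite /P (tgt_term_wf gk) (tgt_term_wf gn).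
have es := congr1 term_src eo; have et := congr1 term_tgt eo.
rewrite !op_im_src // in es; rewrite !op_im_tgt // in et.
congr New; apply: (operad_thin hwf hwf').
  exact: (inj_in_map (A := P) IHP (srcP _ hwk hwf) (srcP _ hwk' hwf') es).
exact: (IHP _ _ (tgtP _ hwk hwf) (tgtP _ hwk' hwf') et).
Qed.

End Plus.

(** * Finiteness of the set of generators *)

Section PtreeInd.
Variable P : ptree -> Prop.
Hypothesis P_leaf : P Leaf.
Hypothesis P_node : forall ts, (forall i u, onth ts i = Some u -> P u) -> P (Node ts).
Lemma ptree_ind' : forall t, P t.
Proof.
fix IH 1; case=> [|ts]; first exact: P_leaf.
apply: P_node; elim: ts => [|t ts IHts] i u; first by move=> e; exfalso; case: i e.
by case: i => [[<-]|i e]; [exact: IH t | exact: IHts e].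
Qed.
End PtreeInd.

Local Open Scope classical_set_scope.

Lemma finite_edges S : finite_set [set p | is_edge S p].
Proof.
case: S => [t|]; last by rewrite (_ : [set p | _] = set0) //; apply/seteqP; split.
elim/ptree_ind': t => [|ts IH].
  by apply: (@sub_finite_set _ _ [set [::]]) => // -[|i p].
apply: (@sub_finite_set _ _ ([set [::]] `|`
    \bigcup_(i in `I_(size ts)) ((cons i) @` [set p | is_edge (onth ts i) p]))).
  move=> [|i p]; first by left.
  rewrite /= /is_edge /=; case e: (onth ts i) => [u|] // hu; right.
  by exists i; [rewrite /= -onthTE e | exists p; rewrite //= e].
rewrite finite_setU; split=> //; apply: bigcup_finite; first exact: finite_II.
move=> i; rewrite /= -onthTE; case e: (onth ts i) => [u|] // _.
by apply: finite_image; exact: IH e.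
Qed.

Lemma finite_uniq_seqs (T : eqType) (L : seq T) :
  finite_set [set s : seq T | uniq s /\ {subset s <= L}].
Proof.
have [A finA HA] : exists2 A : set (seq T), finite_set A & forall s,
    size s <= size L -> {subset s <= L} -> A s.
  elim: (size L) => [|N [A finA HA]]; first by exists [set [::]] => // -[].
  exists ([set [::]] `|` (fun xs => xs.1 :: xs.2) @` ([set` L] `*` A)).
    rewrite finite_setU; split=> //; apply: finite_image; apply: finite_setX => //.
  move=> [|x s]; first by left.
  move=> /= hs sub; right; exists (x, s) => //; split=> /=.
    by apply: sub; rewrite inE eqxx.
  by apply: HA => // y hy; apply: sub; rewrite inE hy orbT.
by apply: sub_finite_set finA => s [us sub]; apply: HA; rewrite ?uniq_leq_size.
Qed.

(** Level by level: an operation is determined by its output and by its inputs,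
    which are distinct colors, so finitely many colors carry finitely many
    operations. *)
Lemma finite_colors S n : finite_set [set c | color_wf S n c].
Proof.
have finE : finite_set (Edge @` [set p | is_edge S p] : set color).
  by apply: finite_image; exact: finite_edges.
elim: n => [|n IH].
  apply: sub_finite_set finE => -[p hp|h /=]; first by exists p.
  by case: term_moment.
suff finW : finite_set [set h | wf S n h].
  apply: (@sub_finite_set _ _ (Edge @` [set p | is_edge S p] `|` New @` [set h | wf S n h])).
    move=> [p hp|h hh]; first by left; exists p.
    right; exists h => //=; move: hh => /=; case e: term_moment => [k|] // /andP[kn hk].
    by apply: wf_level hk _; rewrite e => _ [<-].
  by rewrite finite_setU; split=> //; exact: finite_image.
have /finite_seqP[L eL] := IH.
have wfL c : color_wf S n c -> c \in L by move=> hc; have : [set` L] c by rewrite -eL.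
have fin := finite_setX IH (finite_uniq_seqs L).
pose f h := (term_tgt h, term_src h).
have finj : {in [set h | wf S n h] &, injective f}.
  by move=> h k; rewrite !inE /= => hwf kwf [et es]; exact: (operad_thin hwf kwf).
rewrite -(eq_finite_set (inj_card_eq finj)); apply: sub_finite_set fin.
move=> _ [h hwf <-]; split=> /=; first exact: tgt_term_wf.
split; first exact: src_uniq hwf.
by move=> c /(allP (src_term_wf hwf)) /wfL.
Qed.

Lemma gtgt_inj : injective gtgt.
Proof. by move=> [p|h] [q|k] //= [->]. Qed.

Lemma gtgt_wf S n g : gen_wf S n g -> color_wf S n (gtgt g).
Proof. by case: g => //= p; exact: vertex_edge. Qed.

Lemma finite_gens S n : finite_set [set g | gen_wf S n g].
Proof.
rewrite -(eq_finite_set (inj_card_eq (in2W gtgt_inj))).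
by apply: sub_finite_set (finite_colors S n) => _ [g /gtgt_wf ? <-].
Qed.

(** The injection is given by a relation because the image of a generator will
    be known only through its output color. *)
Lemma card_rel_le (T : choiceType) (A B : set T) (r : T -> T -> Prop) :
  finite_set A -> finite_set B ->
  (forall x, A x -> exists2 y, B y & r x y) ->
  (forall x x' y, r x y -> r x' y -> x = x') ->
  #|` fset_set A| <= #|` fset_set B| /\
  (#|` fset_set B| <= #|` fset_set A| -> forall y, B y -> exists2 x, A x & r x y).
Proof.
move=> finA finB tot inj.
have /boolp.choice[f fP] x : exists y, A x -> B y /\ r x y.
  have [/tot[y By ry]|nA] := pselect (A x); first by exists y.
  by exists x.
pose F := (f @` fset_set A)%fset.
have sub : (F `<=` fset_set B)%fset.
  apply/fsubsetP => _ /imfsetP[x /= + ->]; rewrite !in_fset_set // !inE.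
  by move=> /fP[].
have card : #|` F| = #|` fset_set A|.
  apply: card_in_imfset => x x' /=; rewrite !in_fset_set // !inE.
  by move=> /fP[_ rx] /fP[_ rx'] e; apply: inj rx _; rewrite e.
rewrite -card; split; first exact: fsubset_leq_card.
move=> le y By; have /fsetP/(_ y) : F = fset_set B.
  by apply/eqP; rewrite eqEfcard sub le.
rewrite in_fset_set // mem_set // => /imfsetP[x /= + ->].
by rewrite in_fset_set // inE => Ax; exists x => //; have [] := fP x Ax.
Qed.

(** * A map that is not direct collapses a level or a unary vertex *)

Lemma pairwise_sym_in (T : eqType) (r : rel T) (s : seq T) x y :
  symmetric r -> pairwise r s -> x \in s -> y \in s -> x != y -> r x y.
Proof.
move=> sym; elim: s => //= z s IH /andP[az ps]; rewrite !inE.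
move=> /orP[/eqP->|xs] /orP[/eqP->|ys] neq.
- by rewrite eqxx in neq.
- exact: (allP az).
- by rewrite sym; exact: (allP az).
- exact: IH.
Qed.

Lemma uniq_map_in (T U : eqType) (f : T -> U) s x y :
  uniq (map f s) -> x \in s -> y \in s -> f x = f y -> x = y.
Proof.
elim: s => //= z s IH /andP[nz us]; rewrite !inE => /orP[/eqP->|xs] /orP[/eqP->|ys] //.
- by move=> e; rewrite e map_f in nz.
- by move=> e; rewrite -e map_f in nz.
- exact: IH.
Qed.

Lemma branching (p q : epath) : ~~ prefix p q -> ~~ prefix q p ->
  exists r i j p' q', [/\ p = r ++ i :: p', q = r ++ j :: q' & i != j].
Proof.
elim: p q => [|i p IH] [|j q] //=; case: (eqVneq i j) => [<-|ij] /=.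
  move=> /IH{}IH /IH[r [k [l [p' [q' [-> -> kl]]]]]].
  by exists (i :: r), k, l, p', q'.
by move=> _ _; exists [::], i, j, p, q.
Qed.

Section Map.
Variables (n m : nat) (S R : option ptree) (X : ra_map (RA n S) (RA m R)).

Lemma col_im_inputs p : is_vertex S p ->
  let h := op_im X (corolla S p) in
  [/\ wf R m h, term_tgt h = col_im X (Edge p) &
      term_src h = map (col_im X) (map Edge (inputs S p))].
Proof.
move=> pv h; have cwf := corolla_wf n pv.
by split; [exact: op_im_wf | exact: op_im_tgt | rewrite /h op_im_src // corolla_src].
Qed.

(** Incomparable edges lie below different inputs of some vertex, and the inputs
    of the image of that vertex are incomparable. *)
Lemma incomparable_col_im p q : is_edge S p -> is_edge S q ->
  incomparable (Edge p) (Edge q) ->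
  incomparable (col_im X (Edge p)) (col_im X (Edge q)).
Proof.
move=> hp hq /andP[/branching b /b[r [i [j [p' [q' [ep eq ij]]]]]]].
rewrite ep -cat_rcons in hp *; rewrite eq -cat_rcons in hq *.
have [rv ri] := is_edge_rcons (is_edge_cat hp).
have [_ rj] := is_edge_rcons (is_edge_cat hq).
have [hwf _ hs] := col_im_inputs rv.
have /= := src_incomparable hwf; rewrite hs => pw.
apply: (incomparable_above (c := col_im X (Edge (rcons r i)))
  (d := col_im X (Edge (rcons r j)))).
- have uh := src_uniq hwf; rewrite hs in uh.
  apply: (pairwise_sym_in incomparable_sym pw); rewrite ?map_f //.
  apply: contra ij => /eqP e.
  have [] := uniq_map_in uh (map_f Edge ri) (map_f Edge rj) e.
  by move=> /rcons_inj[->].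
- exact: input_of_above (input_of_col_im X (input_of_edge n hp)).
- exact: input_of_above (input_of_col_im X (input_of_edge n hq)).
Qed.

(** Edges with the same image are comparable.  If q lies below p, say below the
    i-th input of the vertex at p, then by antisymmetry this input has the same
    image as p; so the image of the vertex has its output among its inputs and
    is an identity, which leaves room for one input only. *)
Lemma collapsed_vertex p q : is_edge S p -> is_edge S q ->
  p <> q -> col_im X (Edge p) = col_im X (Edge q) ->
  exists r, [/\ is_vertex S r, inputs S r = [:: rcons r 0]
    & col_im X (Edge (rcons r 0)) = col_im X (Edge r)].
Proof.
wlog pq : p q / prefix p q => [wl|] hp hq neq e.
  have [pq|npq] := boolP (prefix p q); first exact: (wl p q).
  have [qp|nqp] := boolP (prefix q p).
    by apply: (wl q p) => //; exact: nesym.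
  have : incomparable (Edge p) (Edge q) by rewrite /= npq.
  by move=> /(incomparable_col_im hp hq); rewrite e incomparable_irr.
have [r eq] := prefixP pq; case: r eq => [|i r] eq.
  by rewrite eq cats0 in neq.
rewrite eq -cat_rcons in hq e.
have hpi := is_edge_cat hq; have [pv pi] := is_edge_rcons hpi.
have ei : col_im X (Edge (rcons p i)) = col_im X (Edge p).
  apply: (@input_of_anti m R).
    rewrite -cats1; apply: input_of_col_im; apply: input_of_edge; by rewrite cats1.
  by rewrite e; apply: input_of_col_im; exact: input_of_edge.
have [hwf ht hs] := col_im_inputs pv.
have hI := tgt_in_src hwf; rewrite ht hs -ei map_f ?map_f // in hI.
have := congr1 (size \o term_src) (hI isT); rewrite /= hs !size_map => sz.
have ein : inputs S p = [:: rcons p 0].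
  move: sz; rewrite /inputs; case: subtree_at => [[|ts]|] //.
  by rewrite size_map size_iota => ->.
exists p; split=> //; rewrite -ei; congr (col_im X (Edge _)).
by move: pi; rewrite ein inE => /eqP.
Qed.

Lemma not_plus : ~ plus_map X ->
  (exists2 i, i < n & mom_im X (inl i) = mom_im X (inl i.+1)) \/
  (exists r, [/\ is_vertex S r, inputs S r = [:: rcons r 0]
    & col_im X (Edge (rcons r 0)) = col_im X (Edge r)]).
Proof.
move=> np; have [injm|/existsNP[i /existsNP[j]]] := pselect (forall i j,
    i <= n -> j <= n -> mom_im X (inl i) = mom_im X (inl j) -> i = j); last first.
  move=> /not_implyP[hi /not_implyP[hj /not_implyP[e neq]]]; left.
  wlog ij : i j hi hj e neq / i < j => [wl|].
    have [ij|ji|//] := ltngtP i j; first exact: (wl i j).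
    by apply: (wl j i) => //; exact: nesym.
  exists i; first exact: leq_trans ij hj.
  have hi1 : i.+1 <= n by exact: leq_trans ij hj.
  case: (mom_im_cases X) => [[q Eq]|[a [Ea ab am]]]; first by rewrite !Eq.
  rewrite !Ea //; congr inl; apply/eqP; rewrite eqn_leq am //=.
  by move: e; rewrite !Ea // => -[->]; exact: am.
right; have [injc|/existsNP[p /existsNP[q H]]] := pselect (forall p q,
    is_edge S p -> is_edge S q -> col_im X (Edge p) = col_im X (Edge q) -> p = q).
  by case: np.
move: H => /not_implyP[hp /not_implyP[hq /not_implyP[e neq]]].
exact: collapsed_vertex hp hq neq e.
Qed.

End Map.

(** * Direct maps raise the degree *)

Notation deg n S := (DOdeg (n, S)).

Lemma degE n S : deg n S = n + #|` fset_set [set g : gen | gen_wf S n g]%classic|.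
Proof. by []. Qed.

Lemma color_moment0 S n c : color_wf S n c -> color_moment c = inl 0 -> c = Edge [::].
Proof. by case: c => [[|i p]|h] //= H; case: term_moment. Qed.

Section PlusDegree.
Variables (n m : nat) (S R : option ptree) (X : ra_map (RA n S) (RA m R)).
Hypothesis XP : plus_map X.

(** If a vertex were sent to an identity, its only input and its output would
    have the same image. *)
Lemma plus_corolla p : is_vertex S p ->
  exists g hs, op_im X (corolla S p) = App g hs /\ gtgt g = col_im X (Edge p).
Proof.
move=> pv; have [hwf ht hs] := col_im_inputs X pv.
case e: op_im hwf ht hs => [c|g ks] hwf ht hs; last first.
  by exists g, ks; rewrite -ht term_tgt_App.
exfalso; case ei: (inputs S p) hs => [|q [|]] //= [ec].
have iq : q \in inputs S p by rewrite ei inE.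
have [i eq] := inputsP iq; have := XP.2 q p (inputs_edge iq) (vertex_edge pv).
rewrite -ec -ht eq => /(_ erefl) /(congr1 size) /eqP.
by rewrite size_rcons eqn_leq ltnn.
Qed.

Lemma plus_gen g : gen_wf S n g ->
  exists2 g', gen_wf R m g' & gtgt g' = col_im X (gtgt g).
Proof.
case: g => [p|h] gwf.
  have [g [hs [e et]]] := plus_corolla gwf; exists g => //.
  have := op_im_wf X (corolla_wf n gwf); by rewrite e wf_App => /and3P[].
have hwf : color_wf S n (New h) := gwf.
have [d Ed] := col_im_New_plus XP; have [k ek _] := New_lt hwf.
have := col_im_wf X hwf; rewrite (Ed _ _ ek hwf) => w.
by exists (Push (iter (d k) push (op_im X h))); rewrite //= (Ed _ _ ek hwf).
Qed.

Lemma plus_level : n <= m /\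
  (m <= n -> 0 < n -> forall i, i <= n -> mom_im X (inl i) = inl i).
Proof.
have [n0|n0] := leqP n 0; first by split=> //; exact: leq_trans n0 _.
have [a [Ea ab am]] := plus_mom_im XP n0.
have ge i d : i + d <= n -> a i + d <= a (i + d).
  elim: d => [|d IH]; rewrite ?addn0 // !addnS => le.
  exact: leq_ltn_trans (IH (ltnW le)) (am _ _ (ltnSn _) le).
have ge0 i : i <= n -> i <= a i.
  by move=> hi; apply: leq_trans (ge 0 i hi); rewrite leq_addl.
split; first exact: leq_trans (ge0 n (leqnn n)) (ab n (leqnn n)).
move=> mn _ i hi; rewrite Ea //; congr inl; apply/eqP; rewrite eqn_leq ge0 // andbT.
rewrite -(leq_add2r (n - i)) subnKC //.
apply: leq_trans (leq_trans (ab n (leqnn n)) mn).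
by have := ge i (n - i); rewrite subnKC //; apply.
Qed.

(** A generator is sent to an operation whose outermost generator is named by
    the image of the output color, and colors are mapped injectively. *)
Lemma plus_degree : deg n S <= deg m R /\
  (deg m R <= deg n S -> n = m /\
    forall g', gen_wf R m g' -> exists2 g, gen_wf S n g & gtgt g' = col_im X (gtgt g)).
Proof.
rewrite !degE; set A := [set _ | _]%classic; set B := [set _ | _]%classic.
have [le eq] := @card_rel_le _ A B (fun g g' => gen_wf S n g /\ gtgt g' = col_im X (gtgt g))
  (finite_gens S n) (finite_gens R m)
  (fun g gA => let: ex_intro2 g' w e := plus_gen gA in ex_intro2 _ _ g' w (conj gA e))
  (fun g g' k '(conj w e) '(conj w' e') => gtgt_inj
     (plus_col_im XP (gtgt_wf w) (gtgt_wf w') (etrans (esym e) e'))).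
have nm := plus_level.1; split; first exact: leq_add.
move=> H; have mn : m = n.
  apply/eqP; rewrite eqn_leq nm andbT -(leq_add2r #|`fset_set A|).
  by apply: leq_trans H; rewrite leq_add2l.
split=> // g' w; have [|g _ [gw e]] := eq _ g' w; last by exists g.
by move: H; rewrite mn leq_add2l.
Qed.

(** Otherwise the two edges are incomparable or in the opposite order, and both
    relations are preserved. *)
Lemma plus_reflect p r q s : is_edge S p -> is_edge S r ->
  col_im X (Edge p) = Edge q -> col_im X (Edge r) = Edge s -> prefix q s -> prefix p r.
Proof.
move=> hp hr ep er qs; have [//|npr] := boolP (prefix p r).
have [rp|nrp] := boolP (prefix r p).
  have [t ept] := prefixP rp; rewrite ept in hp ep npr.
  have := input_of_above (input_of_col_im X (input_of_edge n hp)); rewrite ep er /= => sq.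
  have sz : size s = size q by apply/eqP; rewrite eqn_leq !size_prefix.
  have esq : s = q by move: qs; rewrite prefixE -sz take_size => /eqP.
  have := XP.2 _ _ hp hr; rewrite ep er esq => /(_ erefl) e.
  by rewrite e prefix_refl in npr.
have : incomparable (Edge p) (Edge r) by rewrite /= npr.
by move=> /(incomparable_col_im X hp hr); rewrite ep er /= qs.
Qed.

Hypothesis level_idm : forall i, i <= n -> mom_im X (inl i) = inl i.
Hypothesis gen_hit : forall g', gen_wf R m g' ->
  exists2 g, gen_wf S n g & gtgt g' = col_im X (gtgt g).

Lemma vertex_hit p : is_vertex R p ->
  exists2 r, is_vertex S r & col_im X (Edge r) = Edge p.
Proof.
move=> pv; have [[r|h] gw /esym e] := gen_hit (pv : gen_wf R m (Vertex p)).
  by exists r.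
have hwf : color_wf S n (New h) := gw; have [k ek [kn _ _]] := New_lt hwf.
have := congr1 color_moment e; rewrite col_im_moment //= ek /= level_idm //.
by case: (p).
Qed.

(** If an input edge q of the vertex of R at p were the output of a further vertex
    inside the image of the corolla, that vertex would be hit by a vertex of S at
    some r.  As r must lie below an input of p, its image lies below an input of
    the image of the corolla; but q lies strictly above all of those that it is
    comparable to. *)
Lemma vertex_fixed p : is_vertex S p -> col_im X (Edge p) = Edge p ->
  is_vertex R p /\ map (col_im X) (map Edge (inputs S p)) = map Edge (inputs R p).
Proof.
move=> pv ep; have [hwf _ hs] := col_im_inputs X pv.
have [g [ks [eh eg]]] := plus_corolla pv; rewrite eh in hwf hs.
move: eg hwf hs; rewrite ep {eh}; case: g => // _ [->].
rewrite wf_App => /and3P[pR /eqP et kwf] /= hs; split=> //.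
have ksId k : k \in ks -> k = Id (term_tgt k).
  move=> kk; case ek: k => [//|g ls]; exfalso; rewrite {}ek in kk.
  have : gtgt g \in map Edge (inputs R p).
    by rewrite -[map _ _]/(gsrc R (Vertex p)) -et -(term_tgt_App g ls) map_f.
  case/mapP=> q qi eg; have [i eq] := inputsP qi.
  have qR : is_vertex R q.
    by have := allP kwf _ kk; rewrite wf_App; case: (g) eg => // u [<-] /andP[].
  have [r rv er] := vertex_hit qR.
  have pq : prefix p q by rewrite eq prefix_rcons.
  have [r' er'] := prefixP (plus_reflect (vertex_edge pv) (vertex_edge rv) ep er pq).
  case: r' er' => [|j r'] er'.
    move: er; rewrite er' cats0 ep eq => -[/(congr1 size)/eqP].
    by rewrite size_rcons eqn_leq ltnn andbF.
  have hr := vertex_edge rv; rewrite er' -cat_rcons in er hr.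
  have [_ ji] := is_edge_rcons (is_edge_cat hr).
  have uj := input_of_above (input_of_col_im X (input_of_edge n hr)); rewrite er in uj.
  have : col_im X (Edge (rcons p j)) \in flatten (map term_src ks) by rewrite hs !map_f.
  case/flattenP=> s /mapP[l hl ->] js.
  have ukj := allP (src_above (allP kwf _ hl)) _ js.
  have tl : term_tgt l = Edge q.
    have : term_tgt l \in map Edge (inputs R p).
      by rewrite -[map _ _]/(gsrc R (Vertex p)) -et map_f.
    case/mapP=> q' qi' etl; have [i' eq'] := inputsP qi'.
    have := above_trans ukj uj; rewrite etl /= eq eq' prefix_rcons2 => /eqP-> //.
  have eqj : col_im X (Edge (rcons p j)) = Edge q.
    move: uj ukj; rewrite tl; case: (col_im _ _) => //= s' u1 u2; congr Edge.
    have sz : size s' = size q by apply/eqP; rewrite eqn_leq !size_prefix.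
    by move: u1; rewrite prefixE sz take_size => /eqP.
  rewrite eqj -tl in js; have lI := tgt_in_src (allP kwf _ hl) js.
  have ut : uniq (map term_tgt ks).
    by rewrite et; have := src_uniq (corolla_wf m pR); rewrite corolla_src.
  have := uniq_map_in ut hl kk; rewrite term_tgt_App eg => /(_ tl).
  by rewrite lI.
rewrite -hs -[RHS]/(gsrc R (Vertex p)) -et -[RHS]flatten_seq1 -map_comp.
congr flatten; apply/eq_in_map => k /ksId e; by rewrite [in LHS]e.
Qed.

Lemma subtree_fixed u p w : subtree_at S p = Some u -> subtree_at R p = Some w ->
  col_im X (Edge p) = Edge p ->
  u = w /\ forall q, is_edge (Some u) q -> col_im X (Edge (p ++ q)) = Edge (p ++ q).
Proof.
elim/ptree_ind': u p w => [|ts IH] p w eu ew ep.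
  split; last by case=> [|i q] // _; rewrite cats0.
  case: w ew => // ws ew; have pR : is_vertex R p by rewrite /is_vertex ew.
  have [r rv er] := vertex_hit pR.
  have := XP.2 r p (vertex_edge rv); rewrite /is_edge eu er ep => /(_ isT erefl) erp.
  by move: rv; rewrite erp /is_vertex eu.
have pv : is_vertex S p by rewrite /is_vertex eu.
have [pR] := vertex_fixed pv ep.
case: w ew => [|ws] ew; first by rewrite /is_vertex ew in pR.
rewrite /inputs eu ew -!map_comp => e.
have sz : size ts = size ws by have := congr1 size e; rewrite !size_map !size_iota.
have ei i : i < size ts -> col_im X (Edge (rcons p i)) = Edge (rcons p i).
  move=> hi; move: e; rewrite -sz => /eq_in_map/(_ i) /=; apply.
  by rewrite mem_iota.
have sub i v : onth ts i = Some v -> onth ws i = Some v /\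
    forall q, is_edge (Some v) q -> col_im X (Edge (p ++ i :: q)) = Edge (p ++ i :: q).
  move=> ev; have hi : i < size ts by rewrite -onthTE ev.
  have := hi; rewrite sz -onthTE; case ev': (onth ws i) => [v'|] // _.
  have [] := IH i v ev (rcons p i) v'.
  - by rewrite -cats1 subtree_at_cat eu /= ev.
  - by rewrite -cats1 subtree_at_cat ew /= ev'.
  - exact: ei.
  - by move=> -> H; split=> // q; rewrite -cat_rcons; exact: H.
split; last first.
  move=> [|i q]; first by rewrite cats0.
  by rewrite /is_edge /=; case ev: (onth ts i) => [v|] //; have [_] := sub _ _ ev; apply.
congr Node; apply: eq_from_onth => i; case ev: (onth ts i) => [v|].
  by have [-> _] := sub _ _ ev.
by apply/esym/onth_default; rewrite -sz leqNgt -onthTE ev.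
Qed.

End PlusDegree.

(** Equal degrees force every generator of the target to be hit.  This rules out
    that the root is sent to an inner edge, for then the root vertex would be
    missed. *)
Lemma plus_degree_eq n m S R (X : ra_map (RA n S) (RA m R)) : plus_map X ->
  deg m R <= deg n S ->
  [/\ n = m, S = R, forall i, i <= n -> mom_im X (inl i) = inl i &
      forall p, is_edge S p -> col_im X (Edge p) = Edge p] \/
  [/\ n = 0, m = 0, S = None & R = Some Leaf].
Proof.
move=> XP le; have [nm hit] := (plus_degree XP).2 le.
have idn : 0 < n -> forall i, i <= n -> mom_im X (inl i) = inl i.
  by apply: (plus_level XP).2; rewrite nm.
case: S X XP le hit idn => [t|] X XP le hit idn.
  have tE : is_edge (Some t) [::] by case: t {X XP le hit idn}.
  have rwf : color_wf R m (col_im X (Edge [::])) by exact: col_im_wf.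
  case: R X XP le hit idn rwf => [w|] X XP le hit idn rwf; last first.
    by rewrite color_wf_empty in rwf.
  have root : col_im X (Edge [::]) = Edge [::].
    have [n0|n0] := posnP n; last first.
      by apply: (color_moment0 rwf); rewrite col_im_root_moment // idn.
    have m0 : m = 0 by rewrite -nm.
    case ec: (col_im X _) rwf => [[|i q]|h] //=; last first.
      by rewrite m0; case: term_moment.
    move=> hq; have wv : is_vertex (Some w) [::] by case: w {X XP le hit idn ec} hq.
    have [[r|h] gw] := hit (Vertex [::]) wv; last first.
      by have [k kn _] := gen_wf_level gw; rewrite n0 in kn.
    have rE := @input_of_edge n _ [::] r (vertex_edge gw).
    move=> e; have := input_of_above (input_of_col_im X rE).
    by rewrite -[col_im X (Edge ([::] ++ r))]e ec.
  have idm_level i : i <= n -> mom_im X (inl i) = inl i.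
    have [n0|n0] := posnP n; last exact: idn.
    move=> hi; have := leq_trans hi (eq_leq n0); rewrite leqn0 => /eqP->.
    by rewrite -col_im_root_moment // root.
  left; have st v : subtree_at (Some v) [::] = Some v by case: v.
  have [etw H] := subtree_fixed XP idm_level hit (st t) (st w) root.
  by split=> //; rewrite etw.
case: R X XP le hit idn => [w|] X XP le hit idn.
  right; case: w X XP le hit idn => [|ws] X XP le hit idn; last first.
    by have [g] := hit (Vertex [::]) isT; rewrite gen_wf_empty.
  have m0 : m = 0.
    apply/eqP; rewrite -leqn0 leqNgt; apply/negP => m0.
    have := hit (Push (Id (Edge [::]))); rewrite /= m0 => /(_ isT)[g].
    by rewrite gen_wf_empty.
  by split=> //; rewrite nm.
left; split=> // i.
have [n0|n0] := posnP n; last exact: idn.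
move=> hi; have := leq_trans hi (eq_leq n0); rewrite leqn0 => /eqP->.
have := @mom_im_wf _ _ _ _ X (inl 0) (leq0n n).
have m0 : m = 0 by rewrite -nm.
by case: mom_im => //= k; rewrite m0 leqn0 => /eqP->.
Qed.

(** The equality of the endpoints is a hypothesis because it is only provable,
    not definitional, where this is used. *)
Lemma identity_criterion (a b : ob DeltaOmega) (X : hom a b) : a = b ->
  (forall i, i <= a.1 -> mom_im X (inl i) = inl i) ->
  (forall p, is_edge a.2 p -> col_im X (Edge p) = Edge p) -> is_identity X.
Proof.
move=> e; case: b / e X => X Em Ec.
suff -> : X = idm a by constructor.
by apply: ra_map_ext => [i hi|p hp]; rewrite ?Em ?Ec // [RHS](mom_im_id, col_im_id).
Qed.

(** * Removing a unary vertex from a planar tree *)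

Fixpoint unary (p : epath) (t : ptree) : bool :=
  match p, t with
  | [::], Node [:: _] => true
  | i :: p', Node ts => if onth ts i is Some u then unary p' u else false
  | _, _ => false
  end.

Fixpoint cut (p : epath) (t : ptree) : ptree :=
  match p, t with
  | [::], Node [:: u] => u
  | i :: p', Node ts =>
      if onth ts i is Some u then Node (set_nth Leaf ts i (cut p' u)) else t
  | _, _ => t
  end.

(** The effect on edges of collapsing the vertex at [p]: its input [rcons p 0] and
    its output [p] both become [p]. *)
Fixpoint collapse (p q : epath) : epath :=
  match p, q with
  | [::], _ :: q' => q'
  | i :: p', j :: q' => if i == j then j :: collapse p' q' else q
  | _, [::] => [::]
  end.

(** The section of [collapse p] that sends the merged edge to the output of the
    collapsed vertex, and therefore fixes the root. *)
Fixpoint upper (p q : epath) : epath :=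
  match p, q with
  | [::], _ :: _ => 0 :: q
  | i :: p', j :: q' => if i == j then j :: upper p' q' else q
  | _, [::] => [::]
  end.

(** The section of [collapse p] that sends the merged edge to the input of the
    collapsed vertex.  It may move the root, but it is the one that preserves
    what hangs below an edge ([shape_cut]). *)
Fixpoint lower (p q : epath) : epath :=
  match p, q with
  | [::], _ => 0 :: q
  | i :: p', j :: q' => if i == j then j :: lower p' q' else q
  | _ :: _, [::] => [::]
  end.

Definition arity (t : ptree) : option nat :=
  if t is Node ts then Some (size ts) else None.
(** What there is at one edge: no edge, a leaf, or a vertex with some number of
    inputs. *)
Definition shape (t : ptree) (p : epath) : option (option nat) :=
  Option.map arity (subtree t p).

Lemma is_edge_shape t p : is_edge (Some t) p = (shape t p != None).
Proof. by rewrite /is_edge /shape /=; case: subtree. Qed.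
Lemma is_leaf_shape t p : is_leaf (Some t) p = (shape t p == Some None).
Proof. by rewrite /is_leaf /shape /=; case: subtree => // -[]. Qed.
Lemma is_vertex_shape t p :
  is_vertex (Some t) p = if shape t p is Some (Some _) then true else false.
Proof. by rewrite /is_vertex /shape /=; case: subtree => // -[]. Qed.
Lemma inputs_shape t p : inputs (Some t) p =
  if shape t p is Some (Some k) then [seq rcons p i | i <- iota 0 k] else [::].
Proof. by rewrite /inputs /shape /=; case: subtree => // -[]. Qed.

Lemma onth_set_nth (T : Type) (x0 y : T) s i j : i < size s ->
  onth (set_nth x0 s i y) j = if j == i then Some y else onth s j.
Proof. by elim: s i j => [|x s IH] [|i] [|j] //= hi; exact: IH. Qed.

Lemma shape_cut p t q : unary p t -> shape (cut p t) q = shape t (lower p q).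
Proof.
elim: p t q => [|i p IH] [|ts] q //=; first by case: ts => [|u [|]].
case e: (onth ts i) => [u|] // pu; case: q => [|j q].
  rewrite /shape /= size_set_nth (maxn_idPr _) //.
  by rewrite -onthTE e.
have hi : i < size ts by rewrite -onthTE e.
rewrite [in LHS]/shape /= onth_set_nth // eq_sym; case: eqP => [<-|_] //=.
by rewrite /shape /= e; exact: IH.
Qed.

Lemma unary_shape p t : unary p t = (shape t p == Some (Some 1)).
Proof.
elim: p t => [|i p IH] [|ts] //=; first by case: ts => [|u [|]].
by rewrite /shape /=; case: (onth ts i) => //= u; exact: IH.
Qed.

Lemma unary_vertex p t : unary p t ->
  is_vertex (Some t) p /\ inputs (Some t) p = [:: rcons p 0].
Proof. by rewrite unary_shape is_vertex_shape inputs_shape => /eqP->. Qed.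

Lemma vertex_unary p t : is_vertex (Some t) p -> inputs (Some t) p = [:: rcons p 0] ->
  unary p t.
Proof.
rewrite unary_shape is_vertex_shape inputs_shape; case: shape => // -[k|] // _.
by move=> /(congr1 size); rewrite size_map size_iota => /= ->.
Qed.

Lemma collapse0 p : collapse p [::] = [::].
Proof. by case: p. Qed.
Lemma upper0 p : upper p [::] = [::].
Proof. by case: p. Qed.
Lemma upperK p q : collapse p (upper p q) = q.
Proof.
elim: p q => [|i p IH] [|j q] //=; case: (eqVneq i j) => [->|ij] /=.
  by rewrite eqxx IH.
by rewrite (negbTE ij).
Qed.
Lemma lowerK p q : collapse p (lower p q) = q.
Proof.
elim: p q => [|i p IH] [|j q] //=; case: (eqVneq i j) => [->|ij] /=.
  by rewrite eqxx IH.
by rewrite (negbTE ij).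
Qed.

Lemma upper_lower p q : q != p -> upper p q = lower p q.
Proof.
elim: p q => [|i p IH] [|j q] //=; case: (eqVneq i j) => [->|] //=.
by rewrite eqseq_cons eqxx => /IH ->.
Qed.
Lemma upper_id p : upper p p = p.
Proof. by elim: p => //= i p ->; rewrite eqxx. Qed.
Lemma lower_id p : lower p p = rcons p 0.
Proof. by elim: p => //= i p ->; rewrite eqxx. Qed.
Lemma collapse_id p : collapse p p = p.
Proof. by rewrite -{2}(upper_id p) upperK. Qed.
Lemma collapse_rcons0 p : collapse p (rcons p 0) = p.
Proof. by rewrite -lower_id lowerK. Qed.

Lemma collapse_rcons p q i : q != p -> collapse p (rcons q i) = rcons (collapse p q) i.
Proof.
elim: p q => [|j p IH] [|k q] //=; first by rewrite collapse0; case: ifP.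
case: (eqVneq j k) => [->|] //=.
by rewrite eqseq_cons eqxx => /IH ->.
Qed.
Lemma upper_rcons p q i : q != p -> upper p (rcons q i) = rcons (upper p q) i.
Proof.
elim: p q => [|j p IH] [|k q] //=; first by rewrite upper0; case: ifP.
case: (eqVneq j k) => [->|] //=.
by rewrite eqseq_cons eqxx => /IH ->.
Qed.
Lemma upper_rcons_id p i : upper p (rcons p i) = rcons (rcons p 0) i.
Proof. by elim: p => //= j p ->; rewrite eqxx. Qed.

Lemma lower_collapse p t q : unary p t -> is_edge (Some t) q -> q != p ->
  lower p (collapse p q) = q.
Proof.
elim: p t q => [|i p IH] [|ts] [|j q] //=.
  by case: ts => [|u [|]] // _; case: j => [|[|j]].
case e: (onth ts i) => [u|] // pu; case: (eqVneq i j) => [<-|ij] /=; last first.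
  by rewrite (negbTE ij).
rewrite eqseq_cons eqxx /= /is_edge /= e => hq qp.
by rewrite (IH u).
Qed.

Lemma upper_collapse p t q : unary p t -> is_edge (Some t) q ->
  upper p (collapse p q) = if q == rcons p 0 then p else q.
Proof.
move=> pu hq; case: (eqVneq q p) => [->|qp].
  by rewrite collapse_id upper_id; case: ifP.
case: eqP => [->|q0]; first by rewrite collapse_rcons0 upper_id.
rewrite upper_lower ?(lower_collapse pu) //; apply/eqP => e; apply: q0.
by rewrite -(lower_collapse pu hq qp) e lower_id.
Qed.

Section Cut.
Variables (p : epath) (t : ptree).
Hypothesis pu : unary p t.

Lemma cut_edge q : is_edge (Some t) q -> is_edge (Some (cut p t)) (collapse p q).
Proof.
move=> hq; rewrite is_edge_shape shape_cut // -is_edge_shape.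
have [->|qp] := eqVneq q p; last by rewrite (lower_collapse pu).
have [pv pin] := unary_vertex pu.
by rewrite collapse_id lower_id; apply: (@inputs_edge _ p); rewrite pin inE.
Qed.

Lemma cut_leaf q : is_leaf (Some t) q -> is_leaf (Some (cut p t)) (collapse p q).
Proof.
move=> hq; have qp : q != p.
  apply: contraTneq hq => ->; rewrite is_leaf_shape.
  by move: pu; rewrite unary_shape => /eqP->.
rewrite is_leaf_shape shape_cut // -is_leaf_shape (lower_collapse pu) //.
by rewrite is_edge_shape; move: hq; rewrite is_leaf_shape => /eqP->.
Qed.

Lemma leaf_cut q : is_leaf (Some (cut p t)) q ->
  exists2 q', is_leaf (Some t) q' & collapse p q' = q.
Proof.
rewrite is_leaf_shape shape_cut // -is_leaf_shape => hq.
by exists (lower p q) => //; exact: lowerK.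
Qed.

Lemma upper_edge q : is_edge (Some (cut p t)) q -> is_edge (Some t) (upper p q).
Proof.
have [->|qp] := eqVneq q p.
  by rewrite upper_id => _; apply: vertex_edge; have [] := unary_vertex pu.
by rewrite upper_lower // is_edge_shape shape_cut // -is_edge_shape.
Qed.

Lemma cut_vertex q : is_vertex (Some t) q -> q != p ->
  is_vertex (Some (cut p t)) (collapse p q) /\
  inputs (Some (cut p t)) (collapse p q) = map (collapse p) (inputs (Some t) q).
Proof.
move=> qv qp; have hq := vertex_edge qv.
rewrite is_vertex_shape !inputs_shape shape_cut // (lower_collapse pu hq qp).
rewrite -is_vertex_shape; split=> //; case: shape => // -[k|] //.
by rewrite -map_comp; apply: eq_map => i /=; rewrite collapse_rcons.
Qed.

Lemma vertex_cut q : is_vertex (Some (cut p t)) q -> q != p ->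
  is_vertex (Some t) (upper p q) /\
  inputs (Some t) (upper p q) = map (upper p) (inputs (Some (cut p t)) q).
Proof.
rewrite is_vertex_shape !inputs_shape shape_cut // => qv qp.
rewrite is_vertex_shape upper_lower //; split=> //; case: shape => // -[k|] //.
by rewrite -map_comp; apply: eq_map => i /=; rewrite upper_rcons // upper_lower.
Qed.

Lemma vertex_cut_id : is_vertex (Some (cut p t)) p ->
  is_vertex (Some t) (rcons p 0) /\
  inputs (Some t) (rcons p 0) = map (upper p) (inputs (Some (cut p t)) p).
Proof.
rewrite is_vertex_shape !inputs_shape shape_cut // lower_id => qv.
rewrite is_vertex_shape; split=> //; case: shape => // -[k|] //.
by rewrite -map_comp; apply: eq_map => i /=; rewrite upper_rcons_id.
Qed.

End Cut.

Lemma cut_cut p q t : unary p t -> unary q t -> ~~ prefix p q ->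
  [/\ unary q (cut p t), unary (collapse q p) (cut q t)
    & cut q (cut p t) = cut (collapse q p) (cut q t)].
Proof.
elim: p q t => [|i p IH] q [|ts] //=; first by rewrite prefix0s.
case ei: (onth ts i) => [u|] // pu.
have hi : i < size ts by rewrite -onthTE ei.
case: q => [|j q].
  by case: ts ei hi => [|u' [|]] //; case: i => [|i] // [->].
move=> /=; case ej: (onth ts j) => [v|] // qv.
have hj : j < size ts by rewrite -onthTE ej.
rewrite /= !onth_set_nth // [in j == i]eq_sym; case: (eqVneq i j) ej => [<-|ij] ej /= npq.
  move: ej; rewrite ei => -[euv]; rewrite -euv in qv.
  have [h1 h2 h3] := IH q u pu qv npq.
  by rewrite onth_set_nth // eqxx -euv h1 h2; split=> //; rewrite h3; congr Node;
    rewrite [LHS]set_set_nth [RHS]set_set_nth !eqxx.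
rewrite ej onth_set_nth // (negbTE ij) ei.
split=> //; congr Node; by rewrite [LHS]set_set_nth (negbTE ij).
Qed.

Lemma collapse_collapse p q t x : unary p t -> unary q t -> ~~ prefix p q ->
  is_edge (Some t) x ->
  collapse q (collapse p x) = collapse (collapse q p) (collapse q x).
Proof.
elim: p q t x => [|i p IH] q [|ts] x //=; first by rewrite prefix0s.
case ei: (onth ts i) => [u|] // pu.
have hi : i < size ts by rewrite -onthTE ei.
case: q => [|j q].
  case: ts ei hi => [|u' [|]] //; case: i => [|i] // [->] _ _ _.
  case: x => [|[|[|k]] x] //=.
  by rewrite collapse0.
move=> /=; case ej: (onth ts j) => [v|] // qv; case: x => [|k x] /=.
  by rewrite collapse0.
rewrite /is_edge /=; case ek: (onth ts k) => [w|] //.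
case: (eqVneq i j) ej => [<-|ij] ej /= npq hx.
  move: ej; rewrite ei => -[euv]; rewrite -euv in qv.
  case: (eqVneq i k) ek => [<-|ik] ek /=; last by rewrite (negbTE ik).
  rewrite eqxx; congr cons; move: ek; rewrite ei => -[euw].
  by apply: (IH q u); rewrite // euw.
case: (eqVneq i k) => [<-|ik] /=; first by rewrite eq_sym (negbTE ij) /= eqxx.
by case: (eqVneq j k) => [<-|jk] /=; rewrite ?(negbTE ij) ?(negbTE ik) ?(negbTE jk).
Qed.

(** The hypothesis excludes the case that p is above q.  If q is [rcons p 0], the
    edges of the cut tree that q merges are p and [rcons p 0]; the section
    [upper p] sends them to [p] and [rcons q 0], which [collapse q] keeps apart. *)
Lemma collapse_upper p q t x : unary p t -> unary q t -> ~~ prefix p q ->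
  is_edge (Some (cut p t)) x ->
  collapse q (upper p x) = upper (collapse q p) (collapse q x).
Proof.
elim: p q t x => [|i p IH] q [|ts] x //=; first by rewrite prefix0s.
case ei: (onth ts i) => [u|] // pu.
have hi : i < size ts by rewrite -onthTE ei.
case: q => [|j q].
  case: ts ei hi => [|u' [|]] //; case: i => [|i] // [->] _ _ _.
  case: x => [|[|[|k]] x] //=.
  by rewrite upper0.
move=> /=; case ej: (onth ts j) => [v|] // qv; case: x => [|k x] /=.
  by rewrite upper0.
rewrite /is_edge /= onth_set_nth //.
case: (eqVneq i j) ej => [<-|ij] ej /= npq.
  move: ej; rewrite ei => -[euv]; rewrite -euv in qv.
  case: (eqVneq k i) => [->|ki] /= hx; last first.
    by rewrite eq_sym (negbTE ki).
  by rewrite eqxx; congr cons; exact: IH hx.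
move=> hx; case: (eqVneq i k) => [<-|ik] /=; first by rewrite eq_sym (negbTE ij) /= eqxx.
by case: (eqVneq j k) => [<-|jk] /=; rewrite ?(negbTE ij) ?(negbTE ik) ?(negbTE jk).
Qed.

(** * Inverse maps and elementary degeneracies *)

Definition minus_map n m S R (X : ra_map (RA n S) (RA m R)) :=
  [/\ forall j, j <= m -> exists2 i, i <= n & mom_im X (inl i) = inl j,
      forall c, color_wf R m c -> exists2 c', color_wf S n c' & col_im X c' = c &
      forall p, is_leaf S p -> exists2 q, is_leaf R q & col_im X (Edge p) = Edge q].

Section Classes.
Variables (a b : ob DeltaOmega) (X : hom a b).

Lemma DOalphaE i : val (DOalpha X i : {x | moment_wf b.2 b.1 x}) = mom_im X (inl (val i)).
Proof. exact: esym (mom_imE X (num a.2 i)). Qed.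

Lemma DObetaE e : val (DObeta X e : O_col b.1 b.2) = col_im X (Edge (val e)).
Proof. exact: esym (col_imE X (edge_col a.1 e)). Qed.

Lemma DOplusE : DOplus X <-> plus_map X.
Proof.
split=> [[inja injb]|[inja injb]]; split.
- move=> i j hi hj e; suff [] : @Ordinal a.1.+1 i hi = @Ordinal a.1.+1 j hj by [].
  by apply: inja; apply: val_inj; rewrite !DOalphaE.
- move=> p q hp hq e; suff : exist _ p hp = exist _ q hq :> edge a.2.
    by move=> /(congr1 val).
  by apply: injb; apply: val_inj; rewrite !DObetaE.
- move=> i j /(congr1 val); rewrite !DOalphaE => e; apply: val_inj.
  by apply: inja e; exact: leq_ord.
- move=> p q /(congr1 val); rewrite !DObetaE => e; apply: val_inj.
  by apply: injb e; exact: valP.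
Qed.

Lemma leaf_edge S p : is_leaf S p -> is_edge S p.
Proof. by rewrite /is_leaf /is_edge; case: subtree_at => // -[]. Qed.

Lemma DOminusE : DOminus X <-> minus_map X.
Proof.
split=> [[oa oc ol]|[oa oc ol]]; split.
- move=> j hj; have [i /(congr1 val)] := oa (@Ordinal b.1.+1 j hj).
  by rewrite DOalphaE => e; exists (val i); first exact: leq_ord.
- move=> c hc; have [c' e] := oc (exist _ c hc).
  exists (val (c' : O_col a.1 a.2)); first exact: valP.
  by rewrite (col_imE X) e.
- move=> p hp; have [q ql /(congr1 val)] := ol (exist _ p (leaf_edge hp)) hp.
  by rewrite DObetaE => e; exists (val q).
- move=> j; have [i hi e] := oa (val j) (leq_ord j).
  by exists (@Ordinal a.1.+1 i hi); apply: val_inj; rewrite DOalphaE.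
- move=> c; have [c' hc' e] := oc (val c) (valP c).
  exists (exist _ c' hc'); apply: val_inj.
  exact: etrans (esym (col_imE X (exist _ c' hc'))) e.
- move=> e el; have [q ql eq] := ol (val e) el.
  exists (exist _ q (leaf_edge ql)) => //; apply: val_inj.
  by rewrite DObetaE.
Qed.

End Classes.

Section Wide.
Variables (n m l : nat) (S R Q : option ptree).
Variables (Y : ra_map (RA m R) (RA l Q)) (X : ra_map (RA n S) (RA m R)).

Lemma plus_comp : plus_map Y -> plus_map X -> plus_map (ra_comp Y X).
Proof.
move=> YP XP; split=> [i j hi hj|p q hp hq]; last first.
  rewrite !col_im_comp // => /(plus_col_im YP); rewrite !col_im_wf // => /(_ isT isT).
  exact: XP.2.
have [n0|n0] := posnP n.
  have := leq_trans hj (eq_leq n0); have := leq_trans hi (eq_leq n0).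
  by rewrite !leqn0 => /eqP-> /eqP->.
have [a [Ea ab _]] := plus_mom_im XP n0; rewrite !mom_im_comp // => e.
by apply: XP.1 => //; move: e; rewrite !Ea // => /YP.1 ->; rewrite ?ab.
Qed.

Lemma plus_cancel : plus_map (ra_comp Y X) -> plus_map X.
Proof.
move=> [P1 P2]; split=> [i j hi hj e|p q hp hq e].
  by apply: P1; rewrite // !mom_im_comp // e.
by apply: P2; rewrite // !col_im_comp // e.
Qed.

Lemma minus_comp : minus_map Y -> minus_map X -> minus_map (ra_comp Y X).
Proof.
move=> [Ya Yc Yl] [Xa Xc Xl]; split.
- move=> k /Ya[j /Xa[i hi ei] ej]; exists i => //.
  by rewrite mom_im_comp // ei.
- move=> c /Yc[d /Xc[e he <-] <-]; exists e => //.
  by rewrite col_im_comp.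
- move=> p hp; have [q /Yl[r hr er] eq] := Xl p hp; exists r => //.
  by rewrite col_im_comp ?eq //; exact: leaf_edge.
Qed.

End Wide.

Lemma plus_id n S : plus_map (ra_id (RA n S)).
Proof.
by split=> [i j _ _|p q _ _]; [rewrite !mom_im_id => -[] | rewrite !col_im_id => -[]].
Qed.

Lemma minus_id n S : minus_map (ra_id (RA n S)).
Proof.
split=> [j hj|c hc|p hp]; first by exists j; rewrite ?mom_im_id.
  by exists c; rewrite ?col_im_id.
by exists p; rewrite ?col_im_id.
Qed.

(** The output color of a generator lifts to a color of the source.  The lift is
    not a leaf, as leaves are sent to leaves, so it is the output of a
    generator. *)
Lemma minus_degree n m S R (X : ra_map (RA n S) (RA m R)) : minus_map X ->
  deg m R <= deg n S.
Proof.
move=> [Xa Xc Xl]; rewrite !degE; apply: leq_add.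
  have /boolp.choice[f fP] (j : 'I_m.+1) :
      exists i : 'I_n.+1, mom_im X (inl (val i)) = inl (val j).
    by have [i hi e] := Xa j (leq_ord j); exists (@Ordinal n.+1 i hi).
  suff /leq_card : injective f by rewrite !card_ord.
  by move=> i j e; have := fP i; rewrite e fP => -[/val_inj].
pose r g' g := gtgt g' = col_im X (gtgt g).
have [] := @card_rel_le _ _ _ r (finite_gens R m) (finite_gens S n) _ _ => //.
  move=> g gw; have [c cw ec] := Xc _ (gtgt_wf gw).
  case: c cw ec => [p|h] cw ec; last by exists (Push h).
  exists (Vertex p) => //=; rewrite -[is_true _]/(is_true (is_vertex S p)).
  have [pl|] := boolP (is_leaf S p); last first.
    by move: cw; rewrite /= /is_edge /is_leaf /is_vertex; case: subtree_at => // -[].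
  have [q ql] := Xl p pl; rewrite ec; case: g gw {ec} => //= v vv [ev].
  by move: vv ql; rewrite ev /is_vertex /is_leaf; case: subtree_at => // -[].
by move=> g g' k e e'; apply: gtgt_inj; rewrite e e'.
Qed.

Lemma plus_minus_id (a b : ob DeltaOmega) (X : hom a b) :
  plus_map X -> minus_map X -> is_identity X.
Proof.
case: a b X => n S [m R] X XP XM.
have [[enm eSR Em Ec]|[_ _ eS eR]] := plus_degree_eq XP (minus_degree XM).
  by apply: identity_criterion => //; move: enm eSR => /= <- <-.
have rw : color_wf R m (Edge [::]) by rewrite /= -[R]/(m, R).2 eR.
case: XM => _ /(_ _ rw)[c cw _] _.
by move: cw; rewrite eS color_wf_empty.
Qed.

Lemma edgewise_comp n m l S R Q (Y : ra_map (RA m R) (RA l Q))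
    (X : ra_map (RA n S) (RA m R)) a f b g : edgewise X a f -> edgewise Y b g ->
  edgewise (ra_comp Y X) (b \o a) (g \o f).
Proof.
move=> [Xa Xf] [Yb Yg]; split=> [i hi|p hp].
  rewrite mom_im_comp // Xa // Yb //.
  by have := @mom_im_wf _ _ _ _ X (inl i) hi; rewrite Xa.
rewrite col_im_comp // Xf // Yg //.
by have := @col_im_wf _ _ _ _ X (Edge p) hp; rewrite Xf.
Qed.

Lemma edgewise_eq n m S R (X Y : ra_map (RA n S) (RA m R)) a f b g :
  edgewise X a f -> edgewise Y b g -> (forall i, i <= n -> a i = b i) ->
  (forall p, is_edge S p -> f p = g p) -> X = Y.
Proof.
move=> [Xa Xf] [Yb Yg] ab fg; apply: ra_map_ext => [i hi|p hp].
  by rewrite Xa // Yb // ab.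
by rewrite Xf // Yg // fg.
Qed.

Lemma edgewise_id n S : edgewise (ra_id (RA n S)) id id.
Proof. by split=> *; rewrite ?mom_im_id ?col_im_id. Qed.

Definition degen i k := if k <= i then k else k.-1.
(** The section of [degen i] that misses [i.+1].  Missing [i] instead would move 0
    for i = 0, but 0 is the moment of the root. *)
Definition face i k := if k <= i then k else k.+1.

Lemma faceK i k : degen i (face i k) = k.
Proof.
by rewrite /degen /face; case: (leqP k i) => [->|] //= ki; rewrite leqNgt ltnW.
Qed.

Lemma corolla_op n S p : is_vertex S p -> exists h,
  [/\ wf S n h, term_src h = map Edge (inputs S p) & term_tgt h = Edge p].
Proof.
by move=> pv; exists (corolla S p); rewrite corolla_src; split=> //; exact: corolla_wf.
Qed.

Lemma degen_map n S i : i < n ->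
  exists X : ra_map (RA n S) (RA n.-1 S), edgewise X (degen i) id.
Proof.
move=> hi; apply: edgewise_exists => // [j k jk kn|j jn|p pv].
- by rewrite /degen; case: ifP; case: ifP; lia.
- by rewrite /degen; case: ifP; lia.
- by rewrite map_id; exact: corolla_op.
Qed.

Lemma face_map n S i : i < n ->
  exists X : ra_map (RA n.-1 S) (RA n S), edgewise X (face i) id.
Proof.
move=> hi; apply: edgewise_exists => // [j k jk kn|j jn|p pv].
- by rewrite /face; case: ifP; case: ifP; lia.
- by rewrite /face; case: ifP; lia.
- by rewrite map_id; exact: corolla_op.
Qed.

Definition unaryS p S := if S is Some t then unary p t else false.
Definition cutS p S := if S is Some t then Some (cut p t) else None.

Lemma collapse_map n S p : unaryS p S ->
  exists X : ra_map (RA n S) (RA n (cutS p S)), edgewise X id (collapse p).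
Proof.
case: S => //= t pu; apply: edgewise_exists => // [|q|q qv]; first exact: collapse0.
  exact: cut_edge.
have [->|qp] := eqVneq q p; last first.
  by have [v <-] := cut_vertex pu qv qp; exact: corolla_op.
have [pv pin] := unary_vertex pu.
exists (Id (Edge (collapse p p))); rewrite wf_Id pin /= collapse_id collapse_rcons0.
by split=> //; have := cut_edge pu (vertex_edge pv); rewrite collapse_id.
Qed.

Lemma upper_map n S p : unaryS p S ->
  exists X : ra_map (RA n (cutS p S)) (RA n S), edgewise X id (upper p).
Proof.
case: S => //= t pu; apply: edgewise_exists => // [|q|q qv]; first exact: upper0.
  exact: upper_edge.
have [eq|qp] := eqVneq q p; last first.
  by have [v <-] := vertex_cut pu qv qp; exact: corolla_op.
rewrite eq in qv *; have [pv pin] := unary_vertex pu.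
have [v vin] := vertex_cut_id pu qv.
(* The vertex of the cut tree at p is the one that hung below the unary vertex; its
   image consists of both, as its output is sent to the output of the unary one. *)
exists (App (Vertex p) [:: corolla (Some t) (rcons p 0)]); split.
- by rewrite wf_App /= pin eqxx pv [all _ _]/= andbT; exact: corolla_wf.
- rewrite -vin -(corolla_src (Some t) (rcons p 0)); exact: cats0.
- by rewrite upper_id.
Qed.

Definition degen_pair i (r a : ob DeltaOmega) (e : hom r a) (d : hom a r) :=
  [/\ i < r.1, a = (r.1.-1, r.2), edgewise e (degen i) id & edgewise d (face i) id].
Definition cut_pair p (r a : ob DeltaOmega) (e : hom r a) (d : hom a r) :=
  [/\ unaryS p r.2, a = (r.1, cutS p r.2), edgewise e id (collapse p)
    & edgewise d id (upper p)].
(** The maps are described by their effect and the object [a] by an equation, so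
    that both can be variables; this avoids transporting maps along equalities of
    objects. *)
Definition elementary (r a : ob DeltaOmega) (e : hom r a) (d : hom a r) :=
  (exists i, degen_pair i e d) \/ (exists p, cut_pair p e d).

Lemma elementaryP (r a : ob DeltaOmega) (e : hom r a) (d : hom a r) : elementary e d ->
  exists al f be g, [/\ edgewise e al f, edgewise d be g, cancel be al, cancel g f &
    (forall q, is_leaf r.2 q -> is_leaf a.2 (f q)) /\
    (forall q, is_leaf a.2 q -> exists2 q', is_leaf r.2 q' & f q' = q)].
Proof.
case=> [[i [hi ea re rd]]|[p [pu ea re rd]]].
  exists (degen i), id, (face i), id; split=> //; first exact: faceK.
  by rewrite ea; split=> // q hq; exists q.
exists id, (collapse p), id, (upper p); split=> //; first exact: upperK.
rewrite ea /=; case: r.2 pu => //= t pu; split=> q; first exact: cut_leaf.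
exact: leaf_cut.
Qed.

Lemma elementary_split (r a : ob DeltaOmega) (e : hom r a) (d : hom a r) : elementary e d ->
  compm e d = idm a.
Proof.
case/elementaryP=> al [f [be [g [re rd albe fg _]]]].
by apply: edgewise_eq (edgewise_comp rd re) (edgewise_id _ _) _ _ => [i _|p _] /=.
Qed.

Lemma elementary_minus (r a : ob DeltaOmega) (e : hom r a) (d : hom a r) : elementary e d ->
  minus_map e.
Proof.
move=> ed; have sp := elementary_split ed.
have [al [f [be [g [re rd albe fg [fl _]]]]]] := elementaryP ed; split.
- move=> j hj; exists (be j).
    by have := @mom_im_wf _ _ _ _ d (inl j) hj; rewrite rd.1.
  by rewrite re.1 ?albe //; have := @mom_im_wf _ _ _ _ d (inl j) hj; rewrite rd.1.
- move=> c hc; exists (col_im d c); first exact: col_im_wf.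
  by rewrite -col_im_comp // -[ra_comp e d]/(compm e d) sp col_im_id.
- move=> p hp; exists (f p); first exact: fl.
  by apply: re.2; exact: leaf_edge.
Qed.

(** The section is direct and cannot be an identity, so it raises the degree. *)
Lemma elementary_deg (r a : ob DeltaOmega) (e : hom r a) (d : hom a r) : elementary e d ->
  DOdeg a < DOdeg r.
Proof.
move=> ed; have dP : plus_map d.
  apply: (@plus_cancel _ _ _ _ _ _ e d).
  by rewrite -[ra_comp e d]/(compm e d) elementary_split //; exact: plus_id.
rewrite ltnNge; apply/negP => le; have := plus_degree_eq dP.
rewrite -!surjective_pairing => /(_ le).
case: ed => [[i [hi ea _ _]]|[p [pu ea re rd]]].
  have ea1 : a.1 = r.1.-1 by rewrite ea.
  by case=> [[e1 _ _ _]|[_ e1 _ _]]; lia.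
case=> [[_ e2 _ Ec]|[_ _ _ e2]]; last by move: pu; rewrite e2; case: (p).
have pe : is_edge a.2 (rcons p 0).
  rewrite e2; case: r.2 pu => //= t pu; have [_ pin] := unary_vertex pu.
  by apply: (@inputs_edge _ p); rewrite pin inE.
have := Ec _ pe; rewrite rd.2 // upper_rcons_id.
by move=> -[/(congr1 size)/eqP]; rewrite !size_rcons eqn_leq ltnn.
Qed.

Lemma elementary_degen i (r b : ob DeltaOmega) (f : hom r b) : i < r.1 ->
  mom_im f (inl i) = mom_im f (inl i.+1) ->
  exists (a : ob DeltaOmega) (e : hom r a) (d : hom a r),
    elementary e d /\ f = compm (compm f d) e.
Proof.
move=> hi eq; have [e re] := degen_map r.2 hi; have [d rd] := face_map r.2 hi.
exists ((r.1.-1, r.2) : ob DeltaOmega), e, d.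
split; first by left; exists i.
have rde := edgewise_comp re rd; rewrite -compmA.
apply: ra_map_ext => [k hk|p hp].
  rewrite [RHS]mom_im_comp // rde.1 //= /degen /face.
  have [ki|ik] := leqP k i; first by rewrite ki.
  have [->|ki] := eqVneq k i.+1; first by rewrite /= leqnn.
  by rewrite leqNgt (_ : i < k.-1) /= ?prednK //; lia.
by rewrite [RHS]col_im_comp // rde.2.
Qed.

Lemma elementary_cut p (r b : ob DeltaOmega) (f : hom r b) : is_vertex r.2 p ->
  inputs r.2 p = [:: rcons p 0] -> col_im f (Edge (rcons p 0)) = col_im f (Edge p) ->
  exists (a : ob DeltaOmega) (e : hom r a) (d : hom a r),
    elementary e d /\ f = compm (compm f d) e.
Proof.
move=> pv pin eq; have pu : unaryS p r.2.
  by case: r.2 pv pin => // t; exact: vertex_unary.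
have [e re] := collapse_map r.1 pu; have [d rd] := upper_map r.1 pu.
exists ((r.1, cutS p r.2) : ob DeltaOmega), e, d.
split; first by right; exists p.
have rde := edgewise_comp re rd; rewrite -compmA.
apply: ra_map_ext => [k hk|q hq].
  by rewrite [RHS]mom_im_comp // rde.1.
rewrite [RHS]col_im_comp // rde.2 //=.
have -> : upper p (collapse p q) = if q == rcons p 0 then p else q.
  by case: r.2 pu hq => // t pu hq; rewrite (upper_collapse pu).
by case: eqP => // ->.
Qed.

Lemma elementary_factor (r b : ob DeltaOmega) (f : hom r b) : ~ plus_map f ->
  exists (a : ob DeltaOmega) (e : hom r a) (d : hom a r),
    elementary e d /\ f = compm (compm f d) e.
Proof.
move=> /not_plus[[i hi eq]|[p [pv pin eq]]]; first exact: elementary_degen hi eq.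
exact: elementary_cut pv pin eq.
Qed.

Lemma minus_cancel (r a b : ob DeltaOmega) (e : hom r a) (d : hom a r)
  (f : hom a b) : elementary e d -> minus_map (compm f e) -> minus_map f.
Proof.
move=> ed [Xa Xc Xl]; have [al [h [be [g [re rd _ _ [_ lf]]]]]] := elementaryP ed; split.
- move=> j /Xa[i hi]; rewrite mom_im_comp // re.1 // => eij; exists (al i) => //.
  by have := @mom_im_wf _ _ _ _ e (inl i) hi; rewrite re.1.
- move=> c /Xc[c' hc']; rewrite col_im_comp // => <-.
  by exists (col_im e c') => //; exact: col_im_wf.
- move=> q /lf[q' hq' <-]; have [s hs] := Xl q' hq'; exists s => //.
  by rewrite -re.2 ?leaf_edge // -col_im_comp //; exact: leaf_edge.
Qed.

Lemma minus_level n m S R (X : ra_map (RA n S) (RA m R)) i : minus_map X -> i <= n ->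
  exists2 j, j <= m & mom_im X (inl i) = inl j.
Proof.
move=> [Xa _ _] hi; case: (mom_im_cases X) => [[q Eq]|[a [Ea ab _]]].
  by have [j hj] := Xa 0 (leq0n m); rewrite Eq.
by exists (a i); rewrite ?ab ?Ea.
Qed.

(** The inverse map [s] sends levels to levels, where [u] is injective; on colors
    [u] is injective anyway. *)
Lemma elementary_kernel (r a b c : ob DeltaOmega) (e : hom r a) (d : hom a r)
  (s : hom r b) (u : hom b c) : elementary e d -> minus_map s -> plus_map u ->
  compm u (compm (compm s d) e) = compm u s -> compm (compm s d) e = s.
Proof.
move=> ed sM uP; have [al [f [be [g [re rd _ _ _]]]]] := elementaryP ed.
rewrite -compmA; have rde := edgewise_comp re rd => eu; apply: ra_map_ext => [i hi|p hp].
  have hbi : be (al i) <= r.1.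
    by have := @mom_im_wf _ _ _ _ (compm d e) (inl i) hi; rewrite rde.1.
  have := congr1 (fun X => mom_im X (inl i)) eu.
  have ei : mom_im d (mom_im e (inl i)) = inl (be (al i)) by rewrite -mom_im_comp // rde.1.
  rewrite !mom_im_comp // ei.
  have [j hj ->] := minus_level sM hi; have [k hk ->] := minus_level sM hbi.
  by move=> /uP.1 -> .
have := congr1 (fun X => col_im X (Edge p)) eu.
rewrite !(col_im_comp _ u) // => /(plus_col_im uP) -> //; exact: col_im_wf.
Qed.

Definition square (r a1 a2 : ob DeltaOmega) (s1 : hom r a1) (d1 : hom a1 r)
    (s2 : hom r a2) :=
  exists (b : ob DeltaOmega) (t1 : hom a1 b) (t2 : hom a2 b) (k : hom b a2),
    [/\ minus_map t1, minus_map t2, compm t2 k = idm b,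
        compm t1 s1 = compm t2 s2 & compm s2 d1 = compm k t1].

Lemma square_split (r a1 a2 : ob DeltaOmega) (s1 : hom r a1) (d1 : hom a1 r)
    (s2 : hom r a2) :
  square s1 d1 s2 -> @split_square DeltaOmega_reedy r a1 a2 s1 d1 s2.
Proof.
move=> [b [t1 [t2 [k [m1 m2 tk c1 c2]]]]]; exists b, t1, t2, k.
by split; [apply/DOminusE | apply/DOminusE | exact: tk | exact: c1 | exact: c2].
Qed.

Lemma square_refl (r a1 a2 : ob DeltaOmega) (e1 : hom r a1) (d1 : hom a1 r)
    (e2 : hom r a2) (d2 : hom a2 r) al f : elementary e1 d1 -> a1 = a2 ->
  edgewise e1 al f -> edgewise e2 al f -> square e1 d1 e2.
Proof.
move=> ed ea; case: a2 / ea e2 d2 => e2 _ re1 re2.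
have <- : e1 = e2 by apply: edgewise_eq re1 re2 _ _.
exists a1, (idm a1), (idm a1), (idm a1); rewrite !comp1m elementary_split //.
by split=> //; exact: minus_id.
Qed.

Lemma degen_elem (r : ob DeltaOmega) i : i < r.1 ->
  exists (e : hom r ((r.1.-1, r.2) : ob DeltaOmega)) (d : hom _ r), degen_pair i e d.
Proof.
move=> hi; have [e re] := degen_map r.2 hi; have [d rd] := face_map r.2 hi.
by exists e, d.
Qed.

Lemma cut_elem (r b : ob DeltaOmega) p : unaryS p r.2 -> b = (r.1, cutS p r.2) ->
  exists (e : hom r b) (d : hom _ r), cut_pair p e d.
Proof.
move=> pu ->; have [e re] := collapse_map r.1 pu; have [d rd] := upper_map r.1 pu.
by exists e, d.
Qed.

(** For i < j the section missing [j.+1] still hits both [i] and [i.+1], so it is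
    compatible with merging them; in the other order this fails for j = i + 1. *)
Lemma degen_square i j (r a1 a2 : ob DeltaOmega) (e1 : hom r a1) (d1 : hom a1 r)
    (e2 : hom r a2) (d2 : hom a2 r) : i < j ->
  degen_pair j e1 d1 -> degen_pair i e2 d2 -> square e1 d1 e2.
Proof.
move=> ij [hj ea1 re1 rd1] [hi ea2 re2 rd2]; subst a1 a2.
have [t1 [u1 tu1]] := @degen_elem (r.1.-1, r.2) i (ltac:(simpl; lia)).
have [t2 [u2 tu2]] := @degen_elem (r.1.-1, r.2) j.-1 (ltac:(simpl; lia)).
have [[_ _ rt1 _] [_ _ rt2 ru2]] := (tu1, tu2).
exists _, t1, t2, u2; split.
- by apply: (elementary_minus (d := u1)); left; exists i.
- by apply: (elementary_minus (d := u2)); left; exists j.-1.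
- by apply: elementary_split; left; exists j.-1.
- apply: edgewise_eq (edgewise_comp re1 rt1) (edgewise_comp re2 rt2) _ _ => //= k _.
  by rewrite /degen; repeat case: ifP; lia.
- apply: edgewise_eq (edgewise_comp rd1 re2) (edgewise_comp rt1 ru2) _ _ => //= k _.
  by rewrite /degen /face; repeat case: ifP; lia.
Qed.

Lemma degen_cut_square i p (r a1 a2 : ob DeltaOmega) (e1 : hom r a1) (d1 : hom a1 r)
    (e2 : hom r a2) (d2 : hom a2 r) :
  degen_pair i e1 d1 -> cut_pair p e2 d2 -> square e1 d1 e2.
Proof.
move=> [hi ea1 re1 rd1] [pu ea2 re2 rd2]; subst a1 a2.
have [t1 [u1 tu1]] := @cut_elem (r.1.-1, r.2) (r.1.-1, cutS p r.2) p pu erefl.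
have [t2 [u2 tu2]] := @degen_elem (r.1, cutS p r.2) i hi.
have [[_ _ rt1 _] [_ _ rt2 ru2]] := (tu1, tu2).
exists _, t1, t2, u2; split.
- by apply: (elementary_minus (d := u1)); right; exists p.
- by apply: (elementary_minus (d := u2)); left; exists i.
- by apply: elementary_split; left; exists i.
- by apply: edgewise_eq (edgewise_comp re1 rt1) (edgewise_comp re2 rt2) _ _.
- by apply: edgewise_eq (edgewise_comp rd1 re2) (edgewise_comp rt1 ru2) _ _.
Qed.

Lemma cut_square p q (r a1 a2 : ob DeltaOmega) (e1 : hom r a1) (d1 : hom a1 r)
    (e2 : hom r a2) (d2 : hom a2 r) : ~~ prefix p q ->
  cut_pair p e1 d1 -> cut_pair q e2 d2 -> square e1 d1 e2.
Proof.
move=> npq [pu ea1 re1 rd1] [qu ea2 re2 rd2]; subst a1 a2.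
have [qu' pu' ec] : [/\ unaryS q (cutS p r.2), unaryS (collapse q p) (cutS q r.2)
    & cutS q (cutS p r.2) = cutS (collapse q p) (cutS q r.2)].
  by case: r.2 pu qu => //= t pu qu; have [? ? ->] := cut_cut pu qu npq.
pose b : ob DeltaOmega := (r.1, cutS q (cutS p r.2)).
have [t1 [u1 tu1]] := @cut_elem (r.1, cutS p r.2) b q qu' erefl.
have [t2 [u2 tu2]] := @cut_elem (r.1, cutS q r.2) b (collapse q p) pu' (congr1 (pair r.1) ec).
have [[_ _ rt1 _] [_ _ rt2 ru2]] := (tu1, tu2).
exists b, t1, t2, u2; split.
- by apply: (elementary_minus (d := u1)); right; exists q.
- by apply: (elementary_minus (d := u2)); right; exists (collapse q p).
- by apply: elementary_split; right; exists (collapse q p).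
- apply: edgewise_eq (edgewise_comp re1 rt1) (edgewise_comp re2 rt2) _ _ => //= x hx.
  by case: r.2 pu qu hx => // t pu qu hx; exact: (collapse_collapse pu qu npq).
- apply: edgewise_eq (edgewise_comp rd1 re2) (edgewise_comp rt1 ru2) _ _ => //= x hx.
  by case: r.2 pu qu hx => // t pu qu hx; exact: (collapse_upper pu qu npq).
Qed.

Lemma elementary_square (r a1 a2 : ob DeltaOmega) (e1 : hom r a1) (d1 : hom a1 r)
  (e2 : hom r a2) (d2 : hom a2 r) : elementary e1 d1 -> elementary e2 d2 ->
  square e1 d1 e2 \/ square e2 d2 e1.
Proof.
move=> ed1 ed2; case: (ed1) (ed2) => [[i si]|[p cp]] [[j sj]|[q cq]].
- have [ij|ji|ij] := ltngtP i j.
  + by right; exact: degen_square ij sj si.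
  + by left; exact: degen_square ji si sj.
  + rewrite -{j}ij in sj; case: si sj => [_ ea1 re1 _] [_ ea2 re2 _]; left.
    by apply: (square_refl d2 ed1 _ re1 re2); rewrite ea1 ea2.
- by left; exact: degen_cut_square si cq.
- by right; exact: degen_cut_square sj cp.
- have [pq|npq] := boolP (prefix p q); last by left; exact: cut_square npq cp cq.
  have [qp|nqp] := boolP (prefix q p); last by right; exact: cut_square nqp cq cp.
  have eqp : q = p.
    have sz : size q = size p by apply/eqP; rewrite eqn_leq !size_prefix.
    by move: qp; rewrite prefixE sz take_size => /eqP.
  rewrite {q}eqp in cq {pq qp}; case: cp cq => [_ ea1 re1 _] [_ ea2 re2 _]; left.
  by apply: (square_refl d2 ed1 _ re1 re2); rewrite ea1 ea2.
Qed.

Theorem theorem3p19 :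
  is_reedy_except (R := DeltaOmega_reedy) degree_exception /\
  elegant DeltaOmega_reedy.
Proof.
apply: (@elegant_criterion DeltaOmega_reedy degree_exception elementary).
- split=> [a|a b c g f /DOplusE gP /DOplusE fP]; apply/DOplusE; first exact: plus_id.
  exact: plus_comp.
- split=> [a|a b c g f /DOminusE gM /DOminusE fM]; apply/DOminusE; first exact: minus_id.
  exact: minus_comp.
- by move=> a b c g f /DOplusE gf; apply/DOplusE; exact: plus_cancel gf.
- move=> a b f /DOplusE fP fni exc; rewrite /= ltnNge; apply/negP => le.
  have := plus_degree_eq fP; rewrite -!surjective_pairing => /(_ le).
  case=> [[e1 e2 Em Ec]|[a1 b1 a2 b2]].
    apply: fni; apply: identity_criterion => //.
    by rewrite [a]surjective_pairing [b]surjective_pairing e1 e2.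
  apply: exc; split; first by rewrite [a]surjective_pairing a1 a2.
  by rewrite [b]surjective_pairing b1 b2.
- by move=> a b f /DOplusE fP /DOminusE fM; exact: plus_minus_id.
- move=> a b f /DOminusE/minus_degree; by rewrite -!surjective_pairing.
- exact: elementary_deg.
- by move=> r a e d ed; apply/DOminusE; exact: elementary_minus ed.
- exact: elementary_split.
- by move=> r b f nf; apply: elementary_factor => fP; apply: nf; apply/DOplusE.
- move=> r a b e d f ed /DOminusE fe; apply/DOminusE; exact: minus_cancel ed fe.
- by move=> r a b c e d s u ed /DOminusE sM /DOplusE uP; exact: elementary_kernel.
- move=> r a1 a2 e1 d1 e2 d2 ed1 ed2.
  have [sq|sq] := elementary_square ed1 ed2; [left|right]; exact: square_split sq.
Qed.
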